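(* Let $\mathcal M$ be a sweep oriented matroid on $\binom{[n]}{2}$ with little oriented matroid $\mathcal L(\mathcal M)$. Then the poset of sweeps of $\mathcal M$ is a strong deformation retract of the poset of pseudo-sweeps of $\mathcal L(\mathcal M)$; and the poset of non-trivial sweeps of $\mathcal M$ is a strong deformation retract of the poset of non-trivial pseudo-sweeps of $\mathcal L(\mathcal M)$.
   Context: Oriented matroids are given by covectors (standard covector axioms), ordered componentwise by $0\prec\pm$; topes are maximal covectors; composition $(X\circ Y)_e=X_e$ if $X_e\ne0$, else $Y_e$. $\binom{[n]}{2}$ is the set of pairs $(i,j)$, $i<j$; for an ordered partition $I$ of $[n]$ with block-index map $p_I$, $X^I_{(i,j)}=+,-,0$ according as $p_I(i)<,>,=p_I(j)$; a sweep oriented matroid is an oriented matroid on $\binom{[n]}{2}$ all of whose covectors are of the form $X^I$. For a covector $X=X^{I_X}$ with $l_X$ blocks, $p_X=p_{I_X}$, $1\le k\le 2l_X+1$, $X^k$ on $[n]\cup\binom{[n]}{2}$ has $X^k_{(i,j)}=X_{(i,j)}$ and $X^k_i=-$ if $p_X(i)\le\lfloor\frac{k-1}{2}\rfloor$, $+$ if $p_X(i)>\lfloor\frac k2\rfloor$, $0$ if $k$ even and $p_X(i)=\frac k2$; the little oriented matroid $\mathcal L(\mathcal M)$ is the restriction to $[n]$ of $\{X^k\}$ (it is acyclic: the all-positive vector $+$ is a tope). The poset of sweeps of $\mathcal M$ is $\{I_X: X\in\mathcal M\}$ ordered by refinement ($J$ refines $I$ if every block of $I$ is a union of consecutive blocks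 of $J$); the trivial sweep is the one-block partition $([n])$. For an acyclic oriented matroid $\mathcal N$ on $[n]$, a cellular string is a sequence $(X^1,\dots,X^m)$ of non-tope covectors with $X^1\circ(+)=+$, $X^m\circ(-)=-$ and $X^i\circ(-)=X^{i+1}\circ(+)$ for all $i$ (here $+$, $-$ are the all-positive/negative vectors). A pseudo-sweep of $\mathcal N$ is the ordered partition $(I_1,\dots,I_m)$ where $I_i$ is the zero set of $X^i$, for a cellular string; the poset of pseudo-sweeps is ordered by refinement. Topological statements about posets refer to their order complexes (simplicial complexes of chains). *)

(* Defs.v *)
From mathcomp Require Import all_boot all_order all_algebra.

Set Implicit Arguments.
Unset Strict Implicit.
Unset Printing Implicit Defensive.

Notation sign := (option bool).

Definition szero : sign := None.
Definition spos : sign := Some true.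
Definition sneg : sign := Some false.

Section SignVectors.
Variable E : finType.
Implicit Types (X Y Z : {ffun E -> sign}) (N : {set {ffun E -> sign}}).

Definition zerov : {ffun E -> sign} := [ffun=> szero].
Definition posv : {ffun E -> sign} := [ffun=> spos].
Definition negv : {ffun E -> sign} := [ffun=> sneg].

Definition oppv X : {ffun E -> sign} := [ffun e => omap negb (X e)].

Definition compv X Y : {ffun E -> sign} :=
  [ffun e => if X e != szero then X e else Y e].

(* the componentwise order induced by 0 < + and 0 < -, with + and - incomparable *)
Definition lev X Y : bool := [forall e, (X e == szero) || (X e == Y e)].

Definition zeroset X : {set E} := [set e | X e == szero].

Definition sepset X Y : {set E} :=
  [set e | (X e != szero) && (Y e == oppv X e)].

Definition oriented_matroid N : Prop :=
  [/\ zerov \in N,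
      forall X, X \in N -> oppv X \in N,
      forall X Y, X \in N -> Y \in N -> compv X Y \in N
    & forall X Y e, X \in N -> Y \in N -> e \in sepset X Y ->
        exists Z, [/\ Z \in N, Z e = szero &
          forall f, f \notin sepset X Y -> Z f = compv X Y f]].

Definition tope N X : bool :=
  (X \in N) && [forall Y in N, lev X Y ==> (Y == X)].

(* The default values of [head] and [last] are chosen so that the empty        *)
(* sequence is a cellular string only if negv = posv, i.e. if E is empty.      *)
Definition cellular_string N (s : seq {ffun E -> sign}) : Prop :=
  [/\ forall X, X \in s -> (X \in N) && ~~ tope N X,
      compv (head negv s) posv = posv,
      compv (last posv s) negv = negv
    & sorted (fun X Y => compv X negv == compv Y posv) s].

End SignVectors.

Definition restrict_inl (A B : finType) (N : {set {ffun (A + B)%type -> sign}}) :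
    {set {ffun A -> sign}} :=
  [set [ffun a => Y (inl a)] | Y : {ffun (A + B)%type -> sign} in N].

Section OrderedPartitions.
Variable n : nat.

Definition pairs : finType := {ij : 'I_n * 'I_n | ij.1 < ij.2}.

(* [partition] includes that the blocks are nonempty.  An ordered partition of *)
(* [n] has at most n blocks, so using n.-bseq instead of seq loses nothing; it *)
(* makes the type finite.                                                      *)
Definition ordpart : finType :=
  {I : n.-bseq {set 'I_n} | uniq I && partition [set:: I] [set: 'I_n]}.

Definition blocks (I : ordpart) : seq {set 'I_n} := val (val I).

(* block indices start at 1 *)
Definition block_index (I : ordpart) (i : 'I_n) : nat :=
  (find (fun B : {set 'I_n} => i \in B) (blocks I)).+1.

Definition sweep_vec (I : ordpart) : {ffun pairs -> sign} :=
  [ffun e : pairs => let p := block_index I in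
     if p (val e).1 < p (val e).2 then spos
     else if p (val e).1 > p (val e).2 then sneg else szero].

Definition sweep_oriented_matroid (M : {set {ffun pairs -> sign}}) : Prop :=
  oriented_matroid M /\
  forall X, X \in M -> exists I : ordpart, X = sweep_vec I.

(* For k > 0 the last case occurs exactly when k is even and                   *)
(* block_index I i = k / 2.                                                    *)
Definition level_vec (I : ordpart) (k : nat) :
    {ffun ('I_n + pairs)%type -> sign} :=
  [ffun x => match x with
     | inl i => if block_index I i <= (k.-1)./2 then sneg
                else if k./2 < block_index I i then spos else szero
     | inr e => sweep_vec I e
     end].

(* I |-> sweep_vec I is injective, so I is the ordered partition of the        *)
(* covector sweep_vec I.                                                       *)
Definition big_om (M : {set {ffun pairs -> sign}}) :
    {set {ffun ('I_n + pairs)%type -> sign}} :=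
  [set Y | [exists I : ordpart, (sweep_vec I \in M) &&
     [exists k : 'I_(2 * size (blocks I)).+2,
        (0 < k) && (Y == level_vec I k)]]].

Definition little_om (M : {set {ffun pairs -> sign}}) :
    {set {ffun 'I_n -> sign}} :=
  restrict_inl (big_om M).

(* J refines I: the blocks of I are, in order, the unions of groups of         *)
(* consecutive blocks of J.                                                    *)
Definition refines (J I : ordpart) : Prop :=
  exists ss : seq (seq {set 'I_n}),
    blocks J = flatten ss /\ blocks I = [seq \bigcup_(C <- s) C | s <- ss].

End OrderedPartitions.

From mathcomp Require Import all_classical all_reals all_analysis.
Import Order.TTheory GRing.Theory Num.Theory.
Import numFieldNormedType.Exports.

Local Open Scope classical_set_scope.
Local Open Scope ring_scope.

Section SweepPosets.
Variable n : nat.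

Definition sweeps (M : {set {ffun pairs n -> sign}}) : set (ordpart n) :=
  [set I | sweep_vec I \in M].

Definition pseudo_sweeps (N : {set {ffun 'I_n -> sign}}) : set (ordpart n) :=
  [set I | exists2 s : seq {ffun 'I_n -> sign},
     cellular_string N s & blocks I = [seq zeroset X | X <- s]].

Definition trivial_sweep (I : ordpart n) : Prop :=
  blocks I = [:: [set: 'I_n]%SET].

Definition nontrivial (P : set (ordpart n)) : set (ordpart n) :=
  [set I | P I /\ ~ trivial_sweep I].

End SweepPosets.

Section Topology.
Variables (R : realType) (T : finType).

Definition order_complex (le : T -> T -> Prop) (P : set T) : set {set T} :=
  [set s : {set T} | [/\ s != finset.set0, (forall x, x \in s -> P x)
     & forall x y, x \in s -> y \in s -> le x y \/ le y x]].

(* Points are given by their barycentric coordinates.  As there are finitely   *)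
(* many vertices, the usual topology of the realization is the one induced by  *)
(* the product topology.                                                       *)
Definition realization (K : set {set T}) : set {ptws T -> R} :=
  [set w : {ptws T -> R} | [/\ (forall x : T, 0 <= w x), \sum_(x : T) w x = 1
     & K (finset (fun x : T => w x != 0))]].

Definition strong_deformation_retract (U : topologicalType) (A X : set U) :=
  A `<=` X /\
  exists H : R * U -> U,
    [/\ {within `[0, 1]%classic `*` X, continuous H},
        (forall t x, 0 <= t <= 1 -> X x -> X (H (t, x))),
        (forall x, X x -> H (0, x) = x),
        (forall x, X x -> A (H (1, x)))
      & forall t a, 0 <= t <= 1 -> A a -> H (t, a) = a].

Definition poset_sdr (le : T -> T -> Prop) (Q P : set T) : Prop :=
  strong_deformation_retract
    (realization (order_complex le Q)) (realization (order_complex le P)).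

End Topology.

(* Main.v *)
(* Both halves compare pseudo-sweeps and sweeps through the same poset.       *)
(* Write sgrow I c for the sign vector telling which elements come before or  *)
(* after c in the ordered partition I.  The covectors of the little oriented  *)
(* matroid L that vanish somewhere are the rows of sweeps, and I is a         *)
(* pseudo-sweep if and only if all its rows lie in L.  Fix an element o and   *)
(* send I to its row at o; nontrivial partitions are those with nonzero row.  *)
(* Over every covector of L that vanishes at o, the fibers of this map in     *)
(* sweeps and in pseudo-sweeps are both contractible, so by Quillen's fiber   *)
(* argument (applied to the mapping cylinder, where only vertices with        *)
(* contractible link are deleted) the smaller poset is a strong deformation   *)
(* retract of the larger one.                                                 *)
(* Contractibility of the fibers is proved by fixing more and more            *)
(* coordinates, respectively rows: the value of the next one ranges over a    *)
(* convex set of covectors, and composition of covectors shows that the       *)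
(* points of a lower fiber lying above a given point form again a fiber of    *)
(* the same kind.                                                             *)

Require Import Defs.
From mathcomp Require Import all_boot all_order all_algebra.
From mathcomp Require Import all_classical all_reals all_analysis.
From mathcomp Require Import zify ring lra.
Import Order.TTheory GRing.Theory Num.Theory.
Import numFieldNormedType.Exports.

Set Implicit Arguments.
Unset Strict Implicit.
Unset Printing Implicit Defensive.

Local Open Scope classical_set_scope.
Local Open Scope ring_scope.

(** * Homotopies of subsets of a topological space *)

(** An ordered partition [I] is studied through its rows: [sgrow I c] records which elements lie
    before, with or after [c]. Refinement is the covector order ([refinesP]). The rows of sweeps are
    covectors of the little oriented matroid L ([row_little]), and a pseudo-sweep is precisely an
    ordered partition all of whose rows lie in L ([pseudo_sweepsP]).

    Fix [o] and send a pseudo-sweep to its row at [o]. A covector of L that vanishes at [o] is also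
    the row at [o] of a sweep, so sweeps and pseudo-sweeps have the same image. A partition is
    trivial exactly when this row is zero ([trivialP]), so both halves of the theorem are instances
    of [sweeps_sdr]. By [quillen_sdr] it is enough that the lower fibers of the map are contractible
    in both posets. By [fiber_contr] it is then enough to treat the partitions with a given row at
    [o], and those among them that refine a given partition.

    For sweeps these are sets of covectors with prescribed coordinates above a given covector, which
    are contractible by composition and elimination ([convex_contr]). For pseudo-sweeps the rows are
    fixed one after another ([pseudo_fiber_contr]). The candidates for the next row form a set of
    the same kind inside L, which satisfies composition and elimination ([little_comp],
    [little_elim]). Every candidate occurs ([pseudo_realize]), because the passage between two topes
    can be completed to a full ranking through any prescribed intermediate covector
    ([crossing_ranks_through]).

    All the topology rests on one explicit homotopy: a vertex with contractible link can be deleted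
    from a flag complex by a strong deformation retraction ([vertex_deletion]). *)

Section WithinP.
Variables (X Y : topologicalType).
Implicit Types A : set X.

Lemma withinP A (f : X -> Y) : {within A, continuous f} <->
  forall x, A x -> forall W, nbhs (f x) W -> \forall y \near x, A y -> W (f y).
Proof.
split=> [/(@subspace_continuousP _ A _ f) cf x Ax W nW|cf].
  exact: (cf x Ax W nW).
by apply/(@subspace_continuousP _ A _ f) => x Ax W nW; exact: cf.
Qed.

Lemma withinPcvg A (f : X -> Y) : {within A, continuous f} <->
  forall x, A x -> f @ within A (nbhs x) --> f x.
Proof. exact: (@subspace_continuousP _ A _ f). Qed.

End WithinP.

Section WithinContinuity.
Variables (X Y Z : topologicalType).
Implicit Types (A C : set X) (B : set Y).

(** The pasting lemma: near a point outside a closed piece, that piece imposes no condition. *)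
Lemma within_cover A C1 C2 (f : X -> Y) : closed C1 -> closed C2 ->
  A `<=` C1 `|` C2 -> {within A `&` C1, continuous f} ->
  {within A `&` C2, continuous f} -> {within A, continuous f}.
Proof.
move=> cC1 cC2 AC /withinP c1 /withinP c2.
have loc (C : set X) : closed C ->
    (forall x, (A `&` C) x -> forall W, nbhs (f x) W ->
      \forall y \near x, (A `&` C) y -> W (f y)) ->
    forall x, A x -> forall W, nbhs (f x) W ->
      \forall y \near x, (A `&` C) y -> W (f y).
  move=> cC cf x Ax W nW; have [Cx|Cx] := pselect (C x); first exact: cf.
  have : \forall y \near x, ~ C y.
    by apply: open_nbhs_nbhs; split => //; exact: closed_openC.
  by apply: filterS => y nCy [].
apply/withinP => x Ax W nW.
have h1 := loc C1 cC1 c1 x Ax W nW; have h2 := loc C2 cC2 c2 x Ax W nW.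
apply: filterS2 h1 h2 => y h1 h2 Ay.
by case: (AC y Ay) => Cy; [apply: h1|apply: h2].
Qed.

Lemma within_pair A (f : X -> Y) (g : X -> Z) :
  {within A, continuous f} -> {within A, continuous g} ->
  {within A, continuous (fun x => (f x, g x))}.
Proof.
move=> /withinPcvg cf /withinPcvg cg.
by apply/withinPcvg => x Ax; apply: cvg_pair; [exact: cf|exact: cg].
Qed.

Lemma within_eq A (f g : X -> Y) : (forall x, A x -> f x = g x) ->
  {within A, continuous f} -> {within A, continuous g}.
Proof.
move=> fg /withinP cf; apply/withinP => x Ax W; rewrite -fg// => /(cf _ Ax).
by apply: filterS => y h Ay; rewrite -fg//; exact: h.
Qed.

Lemma within_sub A A' (f : X -> Y) : A' `<=` A ->
  {within A, continuous f} -> {within A', continuous f}.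
Proof.
move=> AA /withinP cf; apply/withinP => x Ax W /(cf _ (AA _ Ax)).
by apply: filterS => y h /AA; exact: h.
Qed.

Lemma within_cst A (a : Y) : {within A, continuous (fun=> a)}.
Proof. by apply: continuous_subspaceT => x; exact: cvg_cst. Qed.

End WithinContinuity.

Lemma within_comp (X Y Z : topologicalType) (A : set X) (B : set Y)
    (f : X -> Y) (g : Y -> Z) :
  {within A, continuous f} -> (forall x, A x -> B (f x)) ->
  {within B, continuous g} -> {within A, continuous (fun x => g (f x))}.
Proof.
move=> /withinP cf AB /withinP cg.
apply/withinP => x Ax W /(cg _ (AB _ Ax)) /(cf _ Ax).
by apply: filterS => y h Ay; apply: h => //; exact: AB.
Qed.

Section WithinReal.
Variables (R : realType) (X : topologicalType) (A : set X).
Implicit Types f g : X -> R.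

Lemma within_add f g : {within A, continuous f} -> {within A, continuous g} ->
  {within A, continuous (fun x => f x + g x)}.
Proof.
move=> /withinPcvg cf /withinPcvg cg.
by apply/withinPcvg => x Ax; apply: cvgD; [exact: cf|exact: cg].
Qed.

Lemma within_opp f : {within A, continuous f} ->
  {within A, continuous (fun x => - f x)}.
Proof.
move=> /withinPcvg cf.
by apply/withinPcvg => x Ax; apply: cvgN; exact: cf.
Qed.

Lemma within_mul f g : {within A, continuous f} -> {within A, continuous g} ->
  {within A, continuous (fun x => f x * g x)}.
Proof.
move=> /withinPcvg cf /withinPcvg cg.
by apply/withinPcvg => x Ax; apply: cvgM; [exact: cf|exact: cg].
Qed.

Lemma within_id (Z : topologicalType) (D : set Z) :
  {within D, continuous (fun x => x)}.
Proof. by apply: continuous_subspaceT => x; exact: cvg_id. Qed.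

Lemma within_sum (I : Type) (r : seq I) (p : pred I) (f : I -> X -> R) :
  (forall i, {within A, continuous (f i)}) ->
  {within A, continuous (fun x => \sum_(i <- r | p i) f i x)}.
Proof.
move=> cf; elim: r => [|i r IH].
  by apply: within_eq (within_cst (a := 0)) => x _; rewrite big_nil.
apply: (@within_eq _ _ _ (fun x =>
    (if p i then f i x else 0) + \sum_(j <- r | p j) f j x)).
  by move=> x _; rewrite big_cons; case: ifP; rewrite ?add0r.
by apply: within_add => //; case: (p i); [exact: cf|exact: within_cst].
Qed.

Lemma within_min f g : {within A, continuous f} -> {within A, continuous g} ->
  {within A, continuous (fun x => Num.min (f x) (g x))}.
Proof.
move=> cf cg x; exact: (@continuous_min R (subspace A) f g x (cf x) (cg x)).
Qed.

Lemma within_ptws (T : choiceType) (f : X -> {ptws T -> R}) :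
  {within A, continuous f} <->
  (forall y, {within A, continuous (fun x => f x y)}).
Proof.
split=> [cf y|cf].
  apply: (@within_comp _ _ _ A setT f (fun w : {ptws T -> R} => w y)) => //.
  by apply: continuous_subspaceT => w; exact: (@proj_continuous T (fun=> R) y w).
apply/withinPcvg => x Ax; apply/cvg_sup => i.
apply/cvg_image.
  by rewrite eqEsubset; split=> v // _; exists (fun=> v).
move=> W /= nW; have /withinP/(_ x Ax _ nW) h := cf i.
exists ((fun w : T -> R => w i) @^-1` W) => //.
by rewrite eqEsubset; split => [j [? + <-//]|j Wj]; exists (fun=> j).
Qed.

(** Meant for the apex of a star, with [s] the weight of the apex: the bound alone forces [g] to be
    0 at [x] and to tend to 0 there. *)
Lemma squeeze_within (g s : X -> R) (x : X) : s x = 1 -> continuous s ->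
  (forall y, A y -> 2^-1 <= s y -> `|g y| <= 1 - s y) -> A x ->
  forall W, nbhs (g x) W -> \forall y \near x, A y -> W (g y).
Proof.
move=> s1 cs gs Ax W; have -> : g x = 0.
  have := gs x Ax; rewrite s1 subrr normr_le0 => h; apply/eqP/h.
  by rewrite invf_le1// ler1n.
move=> /nbhs_ballP[e /= e0 eW].
have {}eW (r : R) : `|r| < e -> W r.
  by move=> re; apply: eW; rewrite /ball /= sub0r normrN.
have n1 : \forall y \near x, 2^-1 < s y.
  have /cs : nbhs (s x) [set r : R | 2^-1 < r].
    by apply: lt_nbhsr; rewrite s1 invf_lt1// ltr1n.
  exact.
have n2 : \forall y \near x, 1 - e < s y.
  have /cs : nbhs (s x) [set r : R | 1 - e < r].
    by apply: lt_nbhsr; rewrite s1 ltrBlDr ltrDl.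
  exact.
apply: filterS2 n1 n2 => y y2 ye Ay; apply: eW.
apply: le_lt_trans (gs y Ay (ltW y2)) _.
by rewrite ltrBlDr addrC -ltrBlDr.
Qed.

End WithinReal.

(** * Concatenating, composing and cancelling deformations *)

Section Deformations.
Variables (R : realType) (U : topologicalType).
Implicit Types (X Y Z : set U) (H : R * U -> U).

Definition contractible X := exists a H, [/\ X a,
  {within `[0, 1]%classic `*` X, continuous H},
  (forall t x, 0 <= t <= 1 -> X x -> X (H (t, x))),
  (forall x, X x -> H (0, x) = x) & (forall x, X x -> H (1, x) = a)].

Lemma within_slice (t : R) X H : 0 <= t <= 1 ->
  {within `[0, 1]%classic `*` X, continuous H} ->
  {within X, continuous (fun x => H (t, x))}.
Proof.
move=> t01 cH; apply: (within_comp (f := fun x => (t, x)) _ _ cH).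
  by apply: within_pair; [exact: within_cst|by apply: continuous_subspaceT => x; exact: cvg_id].
by move=> x Xx; split => //=; rewrite in_itv.
Qed.

Definition concat H1 H2 : R * U -> U := fun p =>
  if p.1 <= 2^-1 then H1 (2 * p.1, p.2) else H2 (2 * p.1 - 1, H1 (1, p.2)).

Lemma closed_le_fst (a : R) : closed [set p : R * U | p.1 <= a].
Proof.
apply: (@preimage_closed _ _ fst [set x : R | x <= a]).
  by move=> x _; exact: cvg_fst.
by apply: closed_le.
Qed.

Lemma closed_ge_fst (a : R) : closed [set p : R * U | a <= p.1].
Proof.
apply: (@preimage_closed _ _ fst [set x : R | a <= x]).
  by move=> x _; exact: cvg_fst.
by apply: closed_ge.
Qed.

Lemma within_fst (V W : topologicalType) (D : set (V * W)) :
  {within D, continuous (fun p => p.1)}.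
Proof. by apply: continuous_subspaceT => x; exact: cvg_fst. Qed.

Lemma within_snd (V W : topologicalType) (D : set (V * W)) :
  {within D, continuous (fun p => p.2)}.
Proof. by apply: continuous_subspaceT => x; exact: cvg_snd. Qed.

Lemma concat_cont X Y H1 H2 :
  {within `[0, 1]%classic `*` X, continuous H1} ->
  (forall x, X x -> Y (H1 (1, x))) ->
  {within `[0, 1]%classic `*` Y, continuous H2} ->
  (forall x, Y x -> H2 (0, x) = x) ->
  {within `[0, 1]%classic `*` X, continuous (concat H1 H2)}.
Proof.
move=> c1 XY c2 H20.
apply: (within_cover (@closed_le_fst 2^-1) (@closed_ge_fst 2^-1)).
- by move=> -[t x] _ /=; apply/orP; exact: le_total.
- apply: (@within_eq _ _ _ (fun p : R * U => H1 (2 * p.1, p.2))).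
    by move=> [t x] [_ /= t2]; rewrite /concat /= t2.
  apply: (within_comp (f := fun p : R * U => (2 * p.1, p.2)) _ _ c1).
    by apply: within_pair; [apply: within_mul;
      [exact: within_cst|exact: within_fst]|exact: within_snd].
  move=> [t x] [[/= +  Xx] t2]; rewrite in_itv /= => /andP[t0 t1]; split => //=.
  by rewrite in_itv /=; lra.
- apply: (@within_eq _ _ _ (fun p : R * U => H2 (2 * p.1 - 1, H1 (1, p.2)))).
    (* At time 1/2 the two formulas agree because [H2] starts at the identity. *)
    move=> [t x] [[_ Xx] /= t2]; rewrite /concat /=; case: ifPn => // t2'.
    have -> : t = 2^-1 by apply/eqP; rewrite eq_le t2' t2.
    rewrite mulfV ?pnatr_eq0// subrr H20//; exact: XY.
  apply: (within_comp (f := fun p : R * U => (2 * p.1 - 1, H1 (1, p.2))) _ _ c2).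
    apply: within_pair.
      apply: within_add; last exact: within_cst.
      by apply: within_mul; [exact: within_cst|exact: within_fst].
    apply: (within_comp (f := fun p : R * U => (1 : R, p.2)) _ _ c1).
      by apply: within_pair; [exact: within_cst|exact: within_snd].
    by move=> [t x] [[/= _ Xx] t2]; split => //=; rewrite in_itv /=; lra.
  move=> [t x] [[/= +  Xx] t2]; rewrite in_itv /= => /andP[t0 t1]; split => //=.
    by rewrite in_itv /=; lra.
  exact: XY.
Qed.

Let sdr Z X := @strong_deformation_retract R U Z X.

Lemma sdr_refl X : sdr X X.
Proof.
split => //; exists snd; split => //.
exact: within_snd.
Qed.

Lemma sdr_trans X Y Z : sdr Y X -> sdr Z Y -> sdr Z X.
Proof.
move=> [YX [H1 [c1 m1 s1 e1 f1]]] [ZY [H2 [c2 m2 s2 e2 f2]]].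
split; first exact: subset_trans YX.
exists (concat H1 H2); split.
- exact: concat_cont c1 e1 c2 s2.
- move=> t x t01 Xx; rewrite /concat /=; case: ifPn => t2.
    by apply: m1 => //; lra.
  by apply/YX/m2; [move/negP: t2 => /negP; rewrite -ltNge; lra|exact: e1].
- by move=> x Xx; rewrite /concat /= invr_ge0 ler0n mulr0 s1.
- move=> x Xx; rewrite /concat /=; case: ifPn => t2; first by exfalso; lra.
  by rewrite (_ : 2 * 1 - 1 = 1); [exact/e2/e1|lra].
- move=> t a t01 Za; rewrite /concat /=; case: ifPn => t2.
    by apply: f1; [lra|exact: ZY].
  rewrite f1; [|lra|exact: ZY]; apply: f2 => //.
  by move/negP: t2 => /negP; rewrite -ltNge; lra.
Qed.

(** The deformation of [X] onto [Z] may leave [Y]; applying the retraction of [X] onto [Y] at every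
    time brings it back and does not move [Z]. *)
Lemma sdr_cancel X Y Z : Z `<=` Y -> sdr Y X -> sdr Z X -> sdr Z Y.
Proof.
move=> ZY [YX [H1 [c1 m1 s1 e1 f1]]] [ZX [H2 [c2 m2 s2 e2 f2]]].
have o01 : 0 <= (1 : R) <= 1 by rewrite ler01 lexx.
split => //; exists (fun p => H1 (1, H2 p)); split.
- apply: (@within_comp _ _ _ _ X H2 (fun x => H1 (1, x))).
  + by apply: (within_sub _ c2) => -[t x] [? /YX].
  + move=> -[t x] [/= t01 Yx]; apply: m2; last exact: YX.
    by move: t01; rewrite in_itv.
  + exact: (@within_slice 1).
- by move=> t x t01 Yx; apply: e1; apply: m2 => //; exact: YX.
- by move=> x Yx; rewrite s2 ?f1//; exact: YX.
- move=> x Yx; rewrite f1//; first exact/e2/YX.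
  exact/ZY/e2/YX.
- by move=> t a t01 Za; rewrite f2// f1//; exact: ZY.
Qed.

Lemma sdr_contractible X Y : sdr Y X -> contractible X -> contractible Y.
Proof.
move=> [YX [H1 [c1 m1 s1 e1 f1]]] [a [H [Xa cH mH sH eH]]].
have o01 : 0 <= (1 : R) <= 1 by rewrite ler01 lexx.
exists (H1 (1, a)), (fun p => H1 (1, H p)); split.
- exact: e1.
- apply: (@within_comp _ _ _ _ X H (fun x => H1 (1, x))).
  + by apply: (within_sub _ cH) => -[t x] [? /YX].
  + move=> -[t x] [/= t01 Yx]; apply: mH; last exact: YX.
    by move: t01; rewrite in_itv.
  + exact: (@within_slice 1).
- by move=> t x t01 Yx; apply: e1; apply: mH => //; exact: YX.
- by move=> x Yx; rewrite sH ?f1//; exact: YX.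
- by move=> x Yx; rewrite eH//; exact: YX.
Qed.

Lemma contractible_sdr X Y : sdr Y X -> contractible Y -> contractible X.
Proof.
move=> [YX [H1 [c1 m1 s1 e1 f1]]] [a [H [Ya cH mH sH eH]]].
exists a, (concat H1 H); split.
- exact: YX.
- exact: concat_cont c1 e1 cH sH.
- move=> t x t01 Xx; rewrite /concat /=; case: ifPn => t2.
    by apply: m1 => //; lra.
  by apply/YX/mH; [move/negP: t2 => /negP; rewrite -ltNge; lra|exact: e1].
- by move=> x Xx; rewrite /concat /= invr_ge0 ler0n mulr0 s1.
- move=> x Xx; rewrite /concat /=; case: ifPn => t2; first by exfalso; lra.
  by rewrite (_ : 2 * 1 - 1 = 1); [exact/eH/e1|lra].
Qed.

End Deformations.

(** * Flag complexes *)

Section FlagComplex.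
Variables (R : realType) (T : finType) (c : rel T).
Hypotheses (cxx : reflexive c) (csym : symmetric c).
Implicit Types (P Q : {set T}) (v x y : T).
Local Notation U := {ptws T -> R}.

(** The realization of the flag complex of [c] on [P], in barycentric coordinates; an order complex
    is the case of a comparability relation. *)
Definition geo P : set U := [set w : U | [/\ (forall x, 0 <= w x),
  \sum_x w x = 1, (forall x, w x != 0 -> x \in P)
  & forall x y, w x != 0 -> w y != 0 -> c x y]].

Definition mix (t : R) v (w : U) : U :=
  fun x => (1 - t) * w x + t * (x == v)%:R.

Lemma geo_sub P Q : P \subset Q -> geo P `<=` geo Q.
Proof.
by move=> /fintype.subsetP PQ w [w0 w1 wP wc]; split => // x /wP /PQ.
Qed.

Lemma geo_le1 P w x : geo P w -> w x <= 1.
Proof.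
move=> [w0 <- _ _]; rewrite (bigD1 x)//= lerDl.
by apply: sumr_ge0 => y _; exact: w0.
Qed.

Lemma geo_mix P t v w : 0 <= t <= 1 -> v \in P -> geo P w ->
  (forall x, w x != 0 -> c v x) -> geo P (mix t v w).
Proof.
move=> /andP[t0 t1] vP [w0 w1 wP wc] vc.
have nz x : mix t v w x != 0 -> x = v \/ w x != 0.
  rewrite /mix; have [->|xv] := eqVneq x v; first by left.
  by rewrite mulr0 addr0 mulf_eq0 negb_or => /andP[_]; right.
split.
- move=> x; rewrite /mix addr_ge0// mulr_ge0 ?subr_ge0 ?ler0n//; exact: w0.
- rewrite /mix big_split/= -!mulr_sumr w1 (bigD1 v)//= eqxx big1 => [|y /negPf->//].
  by rewrite mulr1 addr0 mulr1 subrK.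
- by move=> x /nz[->//|/wP].
- by move=> x y /nz[->|wx] /nz[->|wy] //; [exact: vc|rewrite csym; exact: vc|exact: wc].
Qed.

Lemma geo_vertex P v : v \in P -> geo P (fun x => (x == v)%:R).
Proof.
move=> vP; split.
- by move=> x; rewrite ler0n.
- by rewrite (bigD1 v)//= eqxx big1 ?addr0// => y /negPf->.
- by move=> x; have [->|] := eqVneq x v; rewrite ?eqxx.
- move=> x y; have [->|] := eqVneq x v; last by rewrite eqxx.
  by have [->|] := eqVneq y v; last by rewrite eqxx.
Qed.

Lemma within_coord (X : topologicalType) (D : set X) (f : X -> U) x :
  {within D, continuous f} -> {within D, continuous (fun p => f p x)}.
Proof. by move=> cf; exact: ((@within_ptws R X D T f).1 cf x). Qed.

Lemma within_mix (X : topologicalType) (D : set X) (t : X -> R) v (f : X -> U) :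
  {within D, continuous t} -> {within D, continuous f} ->
  {within D, continuous (fun p => mix (t p) v (f p))}.
Proof.
move=> ct cf; apply/within_ptws => y; rewrite /mix.
apply: within_add; apply: within_mul; last exact: within_cst.
- by apply: within_add; [exact: within_cst|exact: within_opp].
- exact: within_coord.
- exact: ct.
Qed.

Lemma contractible_cone P v : v \in P -> (forall x, x \in P -> c v x) ->
  contractible R (geo P).
Proof.
move=> vP vc; exists (fun x => (x == v)%:R), (fun p => mix p.1 v p.2); split.
- exact: geo_vertex.
- by apply: within_mix; [exact: within_fst|exact: within_snd].
- move=> t w t01 Pw; apply: geo_mix => // x.
  by case: Pw => _ _ wP _ /wP; exact: vc.
- by move=> w _; apply/funext => x; rewrite /mix subr0 mul1r mul0r addr0.
- by move=> w _; apply/funext => x; rewrite /mix subrr mul1r mul0r add0r.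
Qed.

(** * Deleting a vertex with contractible link *)

Section VertexDeletion.
Variables (P : {set T}) (v : T).
Hypothesis vP : v \in P.
Let lk : {set T} := (P :&: [set x | c v x && (x != v)])%SET.
Variables (a : U) (h : R * U -> U).
Hypotheses (lka : geo lk a)
  (ch : {within `[0, 1]%classic `*` geo lk, continuous h})
  (mh : forall t w, 0 <= t <= 1 -> geo lk w -> geo lk (h (t, w)))
  (sh : forall w, geo lk w -> h (0, w) = w)
  (eh : forall w, geo lk w -> h (1, w) = a).

(* A point of the star of v is (1 - s) x + s v with s = w v and x = nrm w in  *)
(* the link.  Up to time 1/2 the contraction h is applied to x, up to time    *)
(* min 1 (2 s); after that the weight s of v is moved down to 0.  Where       *)
(* s >= 1/2, x has reached a at time 1/2, so the discontinuity of x at the    *)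
(* apex v is harmless.                                                        *)
Let nrm (w : U) : U :=
  if w v == 1 then a else fun x => if x == v then 0 else w x / (1 - w v).
Let tau (p : R * U) : R := Num.min 1 (2 * (p.2 v * Num.min 1 (2 * p.1))).
Let sig (p : R * U) : R := p.2 v * Num.min 1 (2 - 2 * p.1).
Let F (p : R * U) : U := mix (sig p) v (h (tau p, nrm p.2)).
Let H (p : R * U) : U := if p.2 v == 0 then p.2 else F p.

Let star : set U := [set w | geo P w /\ forall x, w x != 0 -> c v x].

Let lkP : lk \subset P.
Proof. by rewrite /lk finset.subsetIl. Qed.

Let starP w : geo P w -> w v != 0 -> star w.
Proof. by move=> Pw wv; split => // x wx; case: Pw => _ _ _; exact. Qed.

Let star01 w : star w -> 0 <= w v <= 1.
Proof. by move=> [Pw _]; rewrite (geo_le1 _ Pw) andbT; case: Pw. Qed.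

Let nrm_lk w : star w -> geo lk (nrm w).
Proof.
move=> sw; have /andP[v0 v1] := star01 sw; rewrite /nrm; case: eqP => // /eqP wv1.
have v1' : 0 < 1 - w v by rewrite subr_gt0 lt_neqAle wv1.
case: sw => -[w0 w1 wP wc] wv; split.
- by move=> x; case: eqP => // _; rewrite divr_ge0// ltW.
- rewrite (bigD1 v)//= eqxx add0r (eq_bigr (fun x => w x / (1 - w v))); last first.
    by move=> x /negPf ->.
  rewrite -mulr_suml; move: w1; rewrite (bigD1 v)//= => e.
  rewrite -[X in _ / (X - _)]e [w v + _]addrC addrK divff//.
  by rewrite (_ : \sum_(i | _) _ = 1 - w v) ?gt_eqF// -e [w v + _]addrC addrK.
- move=> x; have [->|xv] := eqVneq x v; first by rewrite eqxx.
  rewrite mulf_eq0 negb_or => /andP[wx _].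
  by rewrite !inE wP// wv.
- move=> x y; have [->|xv] := eqVneq x v; first by rewrite eqxx.
  have [->|yv] := eqVneq y v; first by rewrite eqxx.
  by rewrite !mulf_eq0 !negb_or => /andP[wx _] /andP[wy _]; exact: wc.
Qed.

Let tau01 t w : 0 <= t <= 1 -> star w -> 0 <= tau (t, w) <= 1.
Proof.
move=> /andP[t0 t1] /star01 /andP[v0 v1]; rewrite /tau /= ge_min lexx /= andbT.
by rewrite le_min ler01 /= mulr_ge0// mulr_ge0// le_min ler01 mulr_ge0.
Qed.

Let sig01 t w : 0 <= t <= 1 -> star w -> 0 <= sig (t, w) <= 1.
Proof.
move=> /andP[t0 t1] /star01 /andP[v0 v1]; rewrite /sig /=.
have m0 : 0 <= Num.min 1 (2 - 2 * t) by rewrite le_min ler01/=; lra.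
have m1 : Num.min 1 (2 - 2 * t) <= 1 by rewrite ge_min lexx.
by rewrite mulr_ge0//= mulr_ile1.
Qed.

(** Where [v] has weight 0 the flow stands still, so [H] is given by [F] on the whole star. *)
Let F_star0 t w : 0 <= t <= 1 -> star w -> w v = 0 -> F (t, w) = w.
Proof.
move=> t01 sw wv; have nw : nrm w = w.
  rewrite /nrm wv eq_sym oner_eq0; apply/funext => x.
  by case: eqP => [->//|_]; rewrite subr0 divr1.
rewrite /F /tau /sig /= nw wv !mul0r mulr0 min_r ?ler01// sh; last first.
  by rewrite -{1}nw; exact: nrm_lk.
by apply/funext => x; rewrite /mix subr0 mul1r mul0r addr0.
Qed.

Let HF t w : 0 <= t <= 1 -> star w -> H (t, w) = F (t, w).
Proof. by move=> t01 sw; rewrite /H /=; case: eqP => // wv; rewrite F_star0. Qed.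

Let F_geo t w : 0 <= t <= 1 -> star w -> geo P (F (t, w)).
Proof.
move=> t01 sw.
have hlk : geo lk (h (tau (t, w), nrm w)) by apply: mh; [exact: tau01|exact: nrm_lk].
apply: geo_mix => //; first exact: sig01.
  exact: geo_sub hlk.
by move=> x; case: hlk => _ _ hP _ /hP; rewrite !inE => /andP[_ /andP[]].
Qed.

Let E : set (R * U) := `[0, 1]%classic `*` star.

Let c_v (D : set (R * U)) x : {within D, continuous (fun p : R * U => p.2 x)}.
Proof. by apply: within_coord; exact: within_snd. Qed.

Let c_tau (D : set (R * U)) : {within D, continuous tau}.
Proof.
apply: within_min; first exact: within_cst.
apply: within_mul; first exact: within_cst.
apply: within_mul; first exact: c_v.
apply: within_min; first exact: within_cst.
by apply: within_mul; [exact: within_cst|exact: within_fst].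
Qed.

Let c_sig (D : set (R * U)) : {within D, continuous sig}.
Proof.
apply: within_mul; first exact: c_v.
apply: within_min; first exact: within_cst.
apply: within_add; first exact: within_cst.
by apply: within_opp; apply: within_mul; [exact: within_cst|exact: within_fst].
Qed.

Let O : set (R * U) := [set p | p.2 v < 1].

Let c_h : {within E `&` O, continuous (fun p => h (tau p, nrm p.2))}.
Proof.
apply: (@within_comp _ _ _ _ _ (fun p => (tau p, nrm p.2)) h _ _ ch).
  apply: within_pair; first exact: c_tau.
  apply/within_ptws => x.
  apply: (@within_eq _ _ _ (fun p : R * U =>
     if x == v then 0 else p.2 x * (1 - p.2 v)^-1)).
    by move=> p [_ Op]; rewrite /nrm lt_eqF.
  case: eqP => _; first exact: within_cst.
  apply: within_mul; first exact: c_v.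
  apply/withinPcvg => p Ep; apply: cvgV.
    by case: Ep => _ Op; rewrite subr_eq0 gt_eqF.
  move: p Ep; apply/withinPcvg; apply: within_add; first exact: within_cst.
  by apply: within_opp; exact: c_v.
move=> [t w] [[/= + sw] _]; rewrite in_itv/= => t01; split; last exact: nrm_lk.
by rewrite /= in_itv; exact: tau01.
Qed.

(** Coordinate [y] of [F p] is that of [mix (sig p) v a] plus [G y p]. Only this term involves
    [nrm], so it carries the whole difficulty at the apex. *)
Let G y (p : R * U) : R := (1 - sig p) * (h (tau p, nrm p.2) y - a y).

(** Up to time 1/2 the first factor is [1 - p.2 v] and the second is a difference of numbers in
    [0, 1]; afterwards the contraction has reached [a] and [G] is 0. *)
Let G_bound y p : E p -> 2^-1 <= p.2 v -> `|G y p| <= 1 - p.2 v.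
Proof.
case: p => t w [/= + sw]; rewrite in_itv/= => t01 wv.
have /andP[v0 v1] := star01 sw; have /andP[t0 t1] := t01.
rewrite /G; have [t2|t2] := leP t 2^-1.
  rewrite {1}/sig /= min_l; last by lra.
  rewrite mulr1 normrM ger0_norm ?subr_ge0// ler_piMr ?subr_ge0//.
  have hlk : geo lk (h (tau (t, w), nrm w)) by apply: mh; [exact: tau01|exact: nrm_lk].
  have h1 := geo_le1 y hlk; have a1 := geo_le1 y lka.
  case: hlk => /(_ y) h0 _ _ _; case: lka => /(_ y) a0 _ _ _.
  by rewrite ler_norml; lra.
have -> : tau (t, w) = 1.
  by rewrite /tau /= (@min_l _ _ 1 (2 * t)); [rewrite mulr1 min_l//; lra|lra].
by rewrite eh ?subrr ?mulr0 ?normr0 ?subr_ge0//; exact: nrm_lk.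
Qed.

Let c_G y : {within E, continuous (G y)}.
Proof.
have cO : {within E `&` O, continuous (G y)}.
  apply: within_mul.
    by apply: within_add; [exact: within_cst|apply: within_opp; exact: c_sig].
  apply: (@within_add R _ _ (fun p => h (tau p, nrm p.2) y) (fun=> - a y)).
    exact: (@within_coord _ (E `&` O) (fun p => h (tau p, nrm p.2)) y c_h).
  exact: within_cst.
have cvv : continuous (fun p : R * U => p.2 v).
  by apply/continuous_subspace_setT; exact: c_v.
apply/withinP => p Ep W nW; have [Op|nOp] := pselect (O p).
  have nO : \forall q \near p, O q.
    have : nbhs (p.2 v) [set x : R | x < 1] by exact: lt_nbhsl.
    exact: cvv.
  move/withinP: cO => /(_ p (conj Ep Op) W nW) nE.
  by apply: filterS2 nO nE => q Oq + Eq; exact.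
have pv1 : p.2 v = 1.
  case: Ep => _ /star01 /andP[_]; rewrite le_eqVlt => /orP[/eqP//|Op].
  by case: nOp.
exact: (@squeeze_within R (R * U)%type E (G y) (fun q : R * U => q.2 v) p pv1 cvv (G_bound y) Ep W nW).
Qed.

Let c_F : {within E, continuous F}.
Proof.
apply/within_ptws => y.
apply: (@within_eq _ _ _ (fun p => a y + sig p * ((y == v)%:R - a y) + G y p)).
  by move=> p _; rewrite /F /mix /G; ring.
apply: (@within_add R (R * U)%type E _ (G y)); last exact: c_G.
apply: within_add; first exact: within_cst.
by apply: within_mul; [exact: c_sig|exact: within_cst].
Qed.

Let c_H : {within `[0, 1]%classic `*` geo P, continuous H}.
Proof.
have cl x : closed [set p : R * U | p.2 x = 0].
  apply: (@preimage_closed _ _ (fun p : R * U => p.2 x) [set 0]).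
    by move=> p _; move: p; apply/continuous_subspace_setT; exact: c_v.
  by apply: closed_eq.
(* The closed pieces are the points without weight at [v], where [H] is the identity, and the points
   supported on vertices joined to [v], where [H] is [F]. *)
apply: (@within_cover (R * U)%type U _ [set p | p.2 v = 0]
    [set p : R * U | forall x, ~~ c v x -> p.2 x = 0]).
- exact: cl.
- rewrite [X in closed X](_ : _ =
      \bigcap_(x in [set x | ~~ c v x]) [set p : R * U | p.2 x = 0]).
    by apply: closed_bigI => x _; exact: cl.
  by apply/seteqP; split.
- move=> [t w] [_ /= Pw]; have [|wv] := eqVneq (w v) 0; [by left|right] => x /=.
  by apply: contraNeq; case: (starP Pw wv) => _; exact.
- apply: (@within_eq _ _ _ snd); last exact: within_snd.
  by move=> p [_ /= pv]; rewrite /H pv eqxx.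
- apply: (@within_eq _ _ _ F).
    move=> [t w] [[/= + Pw] /= wv]; rewrite in_itv => t01; rewrite HF//.
    by split => // x; apply: contraNT => /wv ->.
  apply: within_sub c_F => -[t w] [[/= t01 Pw] wv]; split => //=.
  by split => // x; apply: contraNT => /wv ->.
Qed.

Lemma vertex_deletion_aux : strong_deformation_retract R (geo (P :\ v)%SET) (geo P).
Proof.
have PvP : (P :\ v)%SET \subset P by exact: finset.subsetDl.
split; first exact: geo_sub.
exists H; split.
- exact: c_H.
- move=> t w t01 Pw; rewrite /H /=; case: eqP => // /eqP wv.
  by apply: F_geo => //; exact: starP.
- move=> w Pw; rewrite /H /=; case: eqP => // /eqP wv.
  have sw := starP Pw wv; rewrite /F /tau /sig /= mulr0 subr0.
  rewrite (@min_r _ _ 1 0) ?ler01// !mulr0 (@min_r _ _ 1 0) ?ler01//.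
  rewrite sh; last exact: nrm_lk.
  rewrite min_l ?mulr1; last by lra.
  apply/funext => x; rewrite /mix /nrm.
  have /andP[v0 v1] := star01 sw.
  have [wv1|wv1] := eqVneq (w v) 1.
    rewrite wv1 subrr mul0r add0r mul1r; have [->//|xv] := eqVneq x v.
    have [w0 w1 _ _] := Pw; move: w1; rewrite (bigD1 v)//= wv1 -[X in _ = X]addr0 => /addrI /eqP.
    rewrite psumr_eq0 => [/allP/(_ x)|y _]; last exact: w0.
    by rewrite mem_index_enum xv => /(_ isT) /= /eqP.
  have [->|xv] := eqVneq x v; first by rewrite mulr0 add0r mulr1.
  by rewrite mulr0 addr0 mulrC divfK// subr_eq0 eq_sym.
- move=> w Pw; rewrite /H /=; case: eqP => wv.
    case: Pw => w0 w1 wP wc; split => // x wx; rewrite !inE wP// andbT.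
    by apply: contra_neq wx => ->.
  have sw : star w by apply: starP => //; exact/eqP.
  have hlk : geo lk (h (tau (1, w), nrm w)).
    by apply: mh; [apply: tau01 => //; rewrite ler01 lexx|exact: nrm_lk].
  rewrite /F /sig /= mulr1 subrr (@min_r _ _ 1 0) ?ler01// mulr0.
  rewrite (_ : mix 0 v _ = h (tau (1, w), nrm w)).
    apply: geo_sub hlk; apply/fintype.subsetP => x.
    by rewrite !inE => /andP[-> /andP[_ ->]].
  by apply/funext => x; rewrite /mix subr0 mul1r mul0r addr0.
- move=> t w t01 [w0 w1 wP wc]; rewrite /H /=; case: eqP => // /eqP /wP.
  by rewrite !inE eqxx.
Qed.

End VertexDeletion.

Lemma vertex_deletion P v : v \in P ->
  contractible R (geo (P :&: [set x | c v x && (x != v)])%SET) ->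
  strong_deformation_retract R (geo (P :\ v)%SET) (geo P).
Proof. by move=> vP [a [h [? ? ? ? ?]]]; exact: (@vertex_deletion_aux P v vP a h). Qed.

End FlagComplex.

Close Scope classical_set_scope.

(** * Transport of deformations between complexes *)

Section Transport.
Variables (R : realType) (U V : topologicalType).
Variables (X : set U) (Y : set V) (f : U -> V) (g : V -> U).
Hypotheses (cf : {within X, continuous f}%classic)
  (cg : {within Y, continuous g}%classic).
Hypotheses (XY : forall x, X x -> Y (f x)) (YX : forall y, Y y -> X (g y)).
Hypothesis fg : forall y, Y y -> f (g y) = y.

Let cH (H : R * U -> U) :
  {within (`[0, 1]%classic `*` X)%classic, continuous H}%classic ->
  (forall t x, 0 <= t <= 1 -> X x -> X (H (t, x))) ->
  {within (`[0, 1]%classic `*` Y)%classic,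
    continuous (fun p => f (H (p.1, g p.2)))}%classic.
Proof.
move=> ch mh; apply: (@within_comp _ _ _ _ X (fun p => H (p.1, g p.2))) => //.
  apply: (@within_comp _ _ _ _ _ (fun p : R * V => (p.1, g p.2)) H _ _ ch).
    apply: within_pair; first exact: within_fst.
    apply: (@within_comp _ _ _ _ Y (fun p : R * V => p.2) g) => //.
      exact: within_snd.
    by move=> [t y] [].
  by move=> [t y] [/= t01 Yy]; split => //; exact: YX.
move=> [t y] [/= + Yy]; rewrite in_itv => t01; apply: mh => //; exact: YX.
Qed.

Lemma contractible_transport : contractible R X -> contractible R Y.
Proof.
move=> [a [H [Xa ch mH sH eH]]].
exists (f a), (fun p => f (H (p.1, g p.2))); split.
- exact: XY.
- exact: cH.
- by move=> t y t01 Yy; apply/XY/mH => //; exact: YX.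
- by move=> y Yy; rewrite sH ?fg//; exact: YX.
- by move=> y Yy; rewrite eH//; exact: YX.
Qed.

Lemma sdr_transport (X1 : set U) (Y1 : set V) :
  (Y1 `<=` Y)%classic -> (forall x, X1 x -> Y1 (f x)) ->
  (forall y, Y1 y -> X1 (g y)) ->
  strong_deformation_retract R X1 X -> strong_deformation_retract R Y1 Y.
Proof.
move=> Y1Y XY1 YX1 [X1X [H [ch mH sH eH hH]]]; split => //.
exists (fun p => f (H (p.1, g p.2))); split.
- exact: cH.
- by move=> t y t01 Yy; apply/XY/mH => //; exact: YX.
- by move=> y Yy; rewrite sH ?fg//; exact: YX.
- by move=> y Yy; apply/XY1/eH; exact: YX.
- by move=> t y t01 Yy; rewrite hH ?fg//; [exact: Y1Y|exact: YX1].
Qed.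

End Transport.

Section Embedding.
Variables (R : realType) (T T' : finType) (c : rel T) (c' : rel T') (phi : T -> T').
Hypotheses (phi_inj : injective phi) (phi_c : forall x y, c' (phi x) (phi y) = c x y).
Implicit Types P Q : {set T}.

Let push (w : {ptws T -> R}) : {ptws T' -> R} := fun y => \sum_(x | phi x == y) w x.
Let pull (w : {ptws T' -> R}) : {ptws T -> R} := fun x => w (phi x).

Let push_phi w x : push w (phi x) = w x.
Proof.
rewrite /push (bigD1 x)//= big1 ?addr0// => y /andP[/eqP/phi_inj->].
by rewrite eqxx.
Qed.

Let pull_push w : pull (push w) = w.
Proof. by apply/funext => x; rewrite /pull push_phi. Qed.

Let push_nz w y : push w y != 0 -> exists2 x, y = phi x & w x != 0.
Proof.
apply: contra_neqP => h; rewrite /push big1// => x /eqP xy.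
by apply: contra_notP h => /eqP wx; exists x.
Qed.

Let push_geo P w : @geo R T c P w -> @geo R T' c' (phi @: P) (push w).
Proof.
move=> [w0 w1 wP wc]; split.
- by move=> y; apply: sumr_ge0 => x _; exact: w0.
- rewrite -w1 /push (exchange_big_dep predT)//=; apply: eq_bigr => x _.
  by rewrite (big_pred1 (phi x))// => y; rewrite /= eq_sym.
- by move=> y /push_nz[x -> /wP xP]; apply: imset_f.
- move=> y z /push_nz[x -> wx] /push_nz[x' -> wx'].
  by rewrite phi_c wc.
Qed.

Let pull_nz P w y : @geo R T' c' (phi @: P) w -> w y != 0 -> exists2 x, x \in P & y = phi x.
Proof. by move=> [_ _ wP _] /wP/imsetP[x xP ->]; exists x. Qed.

Let push_pull P w : @geo R T' c' (phi @: P) w -> push (pull w) = w.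
Proof.
move=> wP; apply/funext => y; have [wy|/(pull_nz wP)[x _ ->]] := eqVneq (w y) 0.
  by rewrite wy /push big1// => x /eqP; rewrite /pull => ->.
by rewrite push_phi.
Qed.

Let pull_geo P w : @geo R T' c' (phi @: P) w -> @geo R T c P (pull w).
Proof.
move=> wP; have [w0 w1 _ wc] := wP; split.
- by move=> x; exact: w0.
- rewrite -w1 -{2}(push_pull wP) /push (exchange_big_dep predT)//=.
  by apply: eq_bigr => x _; rewrite (big_pred1 (phi x))// => y; rewrite /= eq_sym.
- by move=> x /(pull_nz wP)[y yP /phi_inj->].
- by move=> x y wx wy; rewrite -phi_c wc.
Qed.

Let c_push D : {within D, continuous push}%classic.
Proof.
apply/within_ptws => y; apply: within_sum => x.
by apply: (@within_coord R T _ D (fun w => w)); exact: within_id.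
Qed.

Let c_pull D : {within D, continuous pull}%classic.
Proof.
apply/within_ptws => x; rewrite /pull.
by apply: (@within_coord R T' _ D (fun w => w)); exact: within_id.
Qed.

Lemma contractible_imset P :
  contractible R (@geo R T' c' (phi @: P)) <-> contractible R (@geo R T c P).
Proof.
split; apply: contractible_transport.
- exact: c_pull.
- exact: c_push.
- by move=> w; exact: pull_geo.
- by move=> w; exact: push_geo.
- by move=> w _; exact: pull_push.
- exact: c_push.
- exact: c_pull.
- by move=> w; exact: push_geo.
- by move=> w; exact: pull_geo.
- by move=> w; exact: push_pull.
Qed.

Lemma sdr_imset P Q : Q \subset P ->
  strong_deformation_retract R (@geo R T' c' (phi @: Q)) (@geo R T' c' (phi @: P)) ->
  strong_deformation_retract R (@geo R T c Q) (@geo R T c P).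
Proof.
move=> QP; apply: (@sdr_transport _ _ _ _ _ pull push).
- exact: c_pull.
- exact: c_push.
- by move=> w; exact: pull_geo.
- by move=> w; exact: push_geo.
- by move=> w _; exact: pull_push.
- exact: geo_sub.
- by move=> w; exact: pull_geo.
- by move=> w; exact: push_geo.
Qed.

End Embedding.

Definition fcontr (R : realType) (T : finType) (c : rel T) (P : {set T}) :=
  contractible R (@geo R T c P).

Definition fsdr (R : realType) (T : finType) (c : rel T) (Q P : {set T}) :=
  strong_deformation_retract R (@geo R T c Q) (@geo R T c P).

Definition compar (T : finType) (le : rel T) : rel T := fun x y => le x y || le y x.

(** * Joins and Quillen's fiber argument *)

Section Join.
Variables (R : realType) (T : finType) (c : rel T).
Hypotheses (cxx : reflexive c) (csym : symmetric c).
Implicit Types (P Q A B : {set T}) (v x y : T).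

Lemma fsdr_contr P Q : fsdr R c Q P -> fcontr R c P <-> fcontr R c Q.
Proof.
by move=> QP; split; [exact: sdr_contractible|exact: contractible_sdr].
Qed.

(** Induction on [B]: the link of a vertex [b] of [B] outside [A] is the join of [A] with the
    neighbours of [b] in the rest of [B], a smaller set of the same form, so [b] can be deleted. *)
Lemma contractible_join A B : fcontr R c A ->
  (forall a b, a \in A -> b \in B -> c a b) -> fcontr R c (A :|: B).
Proof.
have [m] := ubnP #|B|; elim: m B => // m IH B; rewrite ltnS => Bm cA AB.
have [/finset.setUidPl->//|/subsetPn[b bB bA]] := boolP (B \subset A).
have Bb : (#|B :\ b| < m)%N by move: Bm; rewrite (cardsD1 b) bB.
have cAb : fcontr R c (A :|: (B :\ b)).
  by apply: IH => // a y aA /setD1P[_ yB]; exact: AB.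
have e : (A :|: B) :\ b = A :|: (B :\ b).
  by apply/setP => y; rewrite !inE; have [->|//] := eqVneq y b; rewrite (negPf bA).
apply/(@fsdr_contr _ (A :|: (B :\ b))) => //; rewrite -e.
apply: vertex_deletion => //; first by rewrite inE bB orbT.
rewrite (_ : _ :&: _ = A :|: [set y in B :\ b | c b y]).
  apply: IH => //.
    apply: leq_ltn_trans Bb; apply: subset_leq_card.
    by apply/fintype.subsetP => y; rewrite inE => /andP[].
  by move=> a y aA; rewrite !inE => /andP[/andP[_ yB] _]; exact: AB.
apply/setP => y; rewrite !inE; have [->|yb] := eqVneq y b.
  by rewrite (negPf bA) !andbF.
rewrite andbT; have [yA|yA] /= := boolP (y \in A) => //.
by rewrite csym AB.
Qed.

End Join.

Section QuillenA.
Variables (R : realType) (T : finType) (le : rel T).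
Hypotheses (le_refl : reflexive le) (le_trans : transitive le).
Implicit Types (P Q : {set T}) (x y : T).

Local Notation c := (compar le).

Lemma compar_refl : reflexive c.
Proof. by move=> x; rewrite /compar le_refl. Qed.

Lemma compar_sym : symmetric c.
Proof. by move=> x y; rewrite /compar orbC. Qed.

Lemma fcontr_cone P v : v \in P -> (forall x, x \in P -> c v x) -> fcontr R c P.
Proof. exact: contractible_cone compar_refl compar_sym _ _. Qed.

(* Quillen's Theorem A for the inclusion of Q in P. *)
Lemma fsdr_upper P Q : Q \subset P ->
  (forall x, x \in P -> x \notin Q -> fcontr R c [set y in Q | le x y]) ->
  fsdr R c Q P.
Proof.
have [m] := ubnP #|P :\: Q|; elim: m P Q => // m IH P Q; rewrite ltnS => PQm QP up.
have [PQ|/subsetPn[x xP xQ]] := boolP (P \subset Q).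
  by rewrite (_ : Q = P) ?/fsdr; [exact: sdr_refl|apply/eqP; rewrite finset.eqEsubset QP].
have ltm (P' Q' : {set T}) : P' :\: Q' \subset (P :\: Q) :\ x -> (#|P' :\: Q'| < m)%N.
  move=> /subset_leq_card h; apply: leq_ltn_trans h _; move: PQm.
  by rewrite (cardsD1 x) !inE xP xQ.
have QPx : Q \subset P :\ x by rewrite subsetD1 QP.
apply: (@sdr_trans _ _ _ (@geo R T c (P :\ x))); last first.
  apply: IH => //; first by apply: ltm; apply/fintype.subsetP => y; rewrite !inE => /and3P[-> -> ->].
  by move=> y /setD1P[_]; exact: up.
apply: vertex_deletion => //; [exact: compar_refl|exact: compar_sym|].
(* The link of [x] is the join of the elements above [x] with those below. By induction the upper
   part deforms onto its elements in [Q], which are contractible by [up]. *)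
rewrite (_ : _ :&: _ = [set y in P | le x y && (y != x)] :|:
                        [set y in P | le y x && (y != x)]); last first.
  apply/setP => y; rewrite !inE /compar.
  by case: (y \in P); case: (le x y); case: (le y x); case: (y != x).
apply: contractible_join; [exact: compar_refl|exact: compar_sym| |]; last first.
  move=> a b; rewrite !inE /compar => /and3P[_ xa _] /and3P[_ bx _].
  by rewrite (le_trans bx xa) orbT.
apply/(@fsdr_contr _ _ _ _ [set y in Q | le x y]); last exact: up.
apply: IH.
- apply: ltm; apply/fintype.subsetP => y; rewrite !inE.
  by case/and4P => + -> xy ->; rewrite xy !andbT /=.
- apply/fintype.subsetP => y; rewrite !inE => /andP[yQ ->].
  by rewrite (fintype.subsetP QP)//=; apply: contraNneq xQ => <-.
- move=> y; rewrite !inE => /and3P[yP xy yx]; rewrite xy andbT => yQ.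
  have := up y yP yQ; rewrite (_ : [set _ in _ | _] = [set z in [set y in Q | le x y] | le y z])//.
  apply/setP => z; rewrite !inE -andbA; case: (z \in Q) => //=.
  by case yz: (le y z); rewrite ?andbF// (le_trans xy yz).
Qed.

End QuillenA.

Lemma fsdr_lower (R : realType) (T : finType) (le : rel T) (P Q : {set T}) :
  reflexive le -> transitive le -> Q \subset P ->
  (forall x, x \in P -> x \notin Q -> fcontr R (compar le) [set y in Q | le y x]) ->
  fsdr R (compar le) Q P.
Proof.
move=> rle tle QP low.
have e : compar le = compar (fun x y => le y x).
  by apply/funext => x; apply/funext => y; rewrite /compar orbC.
rewrite e; apply: fsdr_upper => //.
- by move=> y x z xy yz; exact: tle yz xy.
- by move=> x xP xQ; rewrite -e; exact: low.
Qed.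

Section QuillenFiber.
Variables (R : realType) (T B : finType) (le : rel T) (leB : rel B) (g : T -> B).
Hypotheses (le_refl : reflexive le) (le_trans : transitive le).
Hypotheses (leB_refl : reflexive leB) (leB_trans : transitive leB).
Variables (P : {set T}) (C : {set B}).
Hypotheses (gPC : forall x, x \in P -> g x \in C)
  (g_mono : forall x y, le x y -> leB (g x) (g y)).

(* The mapping cylinder of g: the elements of B are placed above those of T. *)
Definition cyl : rel (T + B) := fun u v => match u, v with
  | inl x, inl y => le x y
  | inl x, inr b => leB (g x) b
  | inr b, inr b' => leB b b'
  | inr _, inl _ => false
  end.

Let emb (Q : {set T}) (D : {set B}) : {set (T + B)} :=
  [set u | match u with inl x => x \in Q | inr b => b \in D end].

Let cyl_refl : reflexive cyl.
Proof. by case=> [x|b] /=. Qed.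

Let cyl_trans : transitive cyl.
Proof.
move=> [y|y] [x|x] [z|z] //=; [exact: le_trans|..|exact: leB_trans].
- by move=> /g_mono; exact: leB_trans.
- exact: leB_trans.
Qed.

(** Above [x] in [P] outside [Q] lie elements [y] of [Q] and the elements of [C] above [g x]. Each
    such [y] can be removed, as the part of [C] above it is a cone with apex [g y]; what remains is
    a cone with apex [g x]. *)
Let cylinder_base (Q : {set T}) : Q \subset P ->
  fsdr R (compar cyl) (emb Q C) (emb P C).
Proof.
move=> QP; apply: fsdr_upper => //.
  by apply/fintype.subsetP => -[x|b]; rewrite !inE //; exact: (fintype.subsetP QP).
move=> [x|b]; rewrite !inE; last by move=> ->.
move=> xP xQ.
have coneb (y : T) : y \in P ->
    fcontr R (compar cyl) (emb finset.set0 [set b in C | leB (g y) b]).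
  move=> yP; apply: (fcontr_cone _ cyl_refl (v := inr (g y))).
    by rewrite !inE gPC//= leB_refl.
  by case=> [z|b]; rewrite !inE// /compar /= => /andP[_ ->].
apply/(@fsdr_contr _ _ _ _ (emb finset.set0 [set b in C | leB (g x) b])); last exact: coneb.
apply: fsdr_upper => //.
  by apply/fintype.subsetP => -[y|b]; rewrite !inE.
move=> [y|b]; rewrite !inE /=; last by move=> ->.
move=> /andP[yQ xy] _; have yP := fintype.subsetP QP _ yQ.
rewrite (_ : [set _ in _ | _] = emb finset.set0 [set b in C | leB (g y) b]); first exact: coneb.
apply/setP => -[z|b]; rewrite !inE//= -andbA; case: (b \in C) => //=.
by case yz: (leB (g y) b); rewrite ?andbF// (leB_trans (g_mono xy) yz).
Qed.

Let embl (Q : {set T}) : emb Q finset.set0 = inl @: Q.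
Proof.
apply/setP => -[x|b]; rewrite !inE; last by apply/esym/imsetP => -[].
by rewrite mem_imset// => ? ? [].
Qed.

Let embr (D : {set B}) : emb finset.set0 D = inr @: D.
Proof.
apply/setP => -[x|b]; rewrite !inE; first by apply/esym/imsetP => -[].
by rewrite mem_imset// => ? ? [].
Qed.

Let contr_inl (Q : {set T}) : fcontr R (compar cyl) (emb Q finset.set0) <->
  fcontr R (compar le) Q.
Proof. by rewrite embl; apply: contractible_imset => // ? ? []. Qed.

Let cylinder_top (Q : {set T}) : Q \subset P ->
  (forall b, b \in C -> fcontr R (compar le) [set x in Q | leB (g x) b]) ->
  fsdr R (compar cyl) (emb Q finset.set0) (emb Q C).
Proof.
move=> QP fib; apply: fsdr_lower => //.
  by apply/fintype.subsetP => -[x|b]; rewrite !inE.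
move=> [x|b]; rewrite !inE; first by move=> ->.
move=> bC _; move/contr_inl: (fib b bC); congr fcontr.
by apply/setP => -[x|b']; rewrite !inE.
Qed.

(** Both [P] and [C] are deformation retracts of the cylinder, so contractibility passes from [C] to
    [P]. *)
Lemma quillen_contr : fcontr R (compar leB) C ->
  (forall b, b \in C -> fcontr R (compar le) [set x in P | leB (g x) b]) ->
  fcontr R (compar le) P.
Proof.
move=> cC fib; apply/contr_inl.
apply/(fsdr_contr (cylinder_top (fintype.subxx P) fib)).
apply/(fsdr_contr (cylinder_base (finset.sub0set P))).
by rewrite embr; apply/contractible_imset => // ? ? [].
Qed.

(** Both [P] and [Q] are deformation retracts of the cylinder over [P], the latter by way of the
    cylinder over [Q]; [sdr_cancel] then eliminates the cylinder. *)
Lemma quillen_sdr (Q : {set T}) : Q \subset P ->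
  (forall b, b \in C -> fcontr R (compar le) [set x in P | leB (g x) b]) ->
  (forall b, b \in C -> fcontr R (compar le) [set x in Q | leB (g x) b]) ->
  fsdr R (compar le) Q P.
Proof.
move=> QP fP fQ; have inlI : injective (@inl T B) by move=> ? ? [].
apply: (@sdr_imset R T (T + B)%type (compar le) (compar cyl) inl) => //.
rewrite -!embl; apply: (@sdr_cancel _ _ (@geo R _ (compar cyl) (emb P C))).
- by apply: geo_sub; apply/fintype.subsetP => -[x|b]; rewrite !inE//; exact: (fintype.subsetP QP).
- exact: cylinder_top.
- by apply: sdr_trans (cylinder_base QP) _; exact: cylinder_top.
Qed.

End QuillenFiber.

Section ExactFiber.
Variables (R : realType) (T B : finType) (le : rel T) (leB : rel B) (g : T -> B).
Hypotheses (le_refl : reflexive le) (le_trans : transitive le).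
Hypotheses (leB_refl : reflexive leB).

(** The second hypothesis is what [fsdr_upper] asks for in order to deform the lower fiber onto the
    exact fiber over [b]. *)
Lemma fiber_contr (P : {set T}) (b : B) :
  fcontr R (compar le) [set x in P | g x == b] ->
  (forall x, x \in P -> leB (g x) b ->
    fcontr R (compar le) [set y in P | le x y && (g y == b)]) ->
  fcontr R (compar le) [set x in P | leB (g x) b].
Proof.
move=> ex up; apply/(fsdr_contr (Q := [set x in P | g x == b])) => //.
apply: fsdr_upper => //.
  by apply/fintype.subsetP => x; rewrite !inE => /andP[-> /eqP->]; rewrite leB_refl.
move=> x; rewrite inE => /andP[xP xb] _; move: (up x xP xb); congr fcontr.
by apply/setP => y; rewrite !inE -andbA [(g y == b) && _]andbC.
Qed.

End ExactFiber.

Close Scope ring_scope.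

(** * Covectors and ordered partitions *)

Definition les (s t : sign) := (s == szero) || (s == t).

Lemma les_refl : reflexive les.
Proof. by case=> [[]|]. Qed.

Lemma les_trans : transitive les.
Proof. by do 3 case=> [[]|]. Qed.

Section Lev.
Variable E : finType.
Implicit Types X Y Z : {ffun E -> sign}.

Lemma levP X Y : reflect (forall e, les (X e) (Y e)) (lev X Y).
Proof. exact: forallP. Qed.

Lemma lev_refl : reflexive (@lev E).
Proof. by move=> X; apply/levP => e; exact: les_refl. Qed.

Lemma lev_trans : transitive (@lev E).
Proof.
by move=> Y X Z /levP XY /levP YZ; apply/levP => e; exact: les_trans (XY e) (YZ e).
Qed.

Lemma lev_comp X Y : lev X (compv X Y).
Proof. by apply/levP => e; rewrite ffunE; case: (X e) => [[]|]. Qed.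

End Lev.

(** * Contractibility of convex sets of covectors *)

Section Convexity.
Variables (R : realType) (T E : finType) (phi : T -> {ffun E -> sign}) (N : {set T}).
Hypotheses
  (Ncomp : forall x y, x \in N -> y \in N ->
    exists2 z, z \in N & phi z = compv (phi x) (phi y))
  (Nelim : forall x y e, x \in N -> y \in N -> e \in sepset (phi x) (phi y) ->
    exists z, [/\ z \in N, phi z e = szero & forall f,
      f \notin sepset (phi x) (phi y) -> phi z f = compv (phi x) (phi y) f]).

Let le : rel T := fun x y => lev (phi x) (phi y).

(** This family is stable under fixing one more coordinate and under passing to the elements above a
    member, as the induction in [convex_contr] requires. *)
Definition face_in (A : {set E}) (Z : {ffun E -> sign}) x0 : {set T} :=
  [set x in N | lev Z (phi x) && [forall a in A, phi x a == phi x0 a]].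

(** Induction on the coordinates outside [A], applying [quillen_contr] to the value at a new
    coordinate [e]. Exact fibers have [e] added to [A], and elimination makes the image
    contractible. *)
Lemma convex_contr A Z x0 : x0 \in N -> lev Z (phi x0) ->
  fcontr R (compar le) (face_in A Z x0).
Proof.
have le_refl : reflexive le by move=> x; exact: lev_refl.
have le_trans : transitive le by move=> x y z; exact: lev_trans.
have [m] := ubnP #|~: A|; elim: m A Z x0 => // m IH A Z x0; rewrite ltnS => Am x0N Zx0.
have x0F : x0 \in face_in A Z x0.
  by rewrite inE x0N Zx0; apply/forall_inP.
have [AT|] := boolP ([set: E] \subset A).
  apply: (fcontr_cone R le_refl x0F) => x; rewrite inE => /and3P[_ _ /forall_inP xx0].
  rewrite /compar /le (_ : phi x = phi x0) ?lev_refl//; apply/ffunP => e.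
  by apply/eqP/xx0/(fintype.subsetP AT).
move=> /subsetPn[e _ eA].
have Fe (y : T) : y \in face_in A Z x0 -> forall a, a \in A -> phi y a = phi x0 a.
  by rewrite inE => /and3P[_ _ /forall_inP h] a aA; apply/eqP/h.
have IHe Z' y : y \in N -> lev Z' (phi y) -> fcontr R (compar le) (face_in (e |: A) Z' y).
  apply: IH; apply: leq_trans Am; apply: proper_card; apply/properP; split.
    by apply/fintype.subsetP => a; rewrite !inE negb_or => /andP[].
  by exists e; rewrite !inE ?eqxx.
pose F := face_in A Z x0.
pose g x := phi x e.
(* These are the elements above [x] that agree on [e |: A] with the composition of [x] and [y]. *)
have up x b y : x \in F -> y \in F -> les (g x) b -> g y = b ->
    fcontr R (compar le) [set y in F | le x y && (g y == b)].
  move=> xF yF xb yb; have [xN yN] : x \in N /\ y \in N.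
    by move: xF yF; rewrite !inE => /andP[-> _] /andP[-> _].
  have [z zN ez] := Ncomp xN yN.
  have xz : lev (phi x) (phi z) by rewrite ez lev_comp.
  have := IHe (phi x) z zN xz; congr fcontr; apply/setP => w.
  have za a : a \in A -> phi z a = phi x0 a.
    by move=> aA; rewrite ez ffunE (Fe x)// (Fe y)//; case: (phi x0 a).
  have zb : phi z e = b.
    by rewrite ez ffunE -/(g x) -/(g y) yb; move: xb; rewrite /les; case: eqP => //= _ /eqP.
  rewrite !inE /le /g; have [wN|//] := boolP (w \in N).
  have [xw|_] := boolP (lev (phi x) (phi w)); last by rewrite /= !andbF.
  rewrite (lev_trans _ xw)/=; last by move: xF; rewrite inE => /and3P[].
  apply/forall_inP/andP => [h|[/forall_inP h /eqP we] a].
    split; last by rewrite (eqP (h e _)) ?inE ?eqxx ?zb.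
    by apply/forall_inP => a aA; rewrite (eqP (h a _)) ?za// !inE aA orbT.
  by rewrite !inE => /orP[/eqP->|aA]; [rewrite we zb|rewrite (eqP (h a aA)) za].
apply: (@quillen_contr R _ _ le les g le_refl le_trans les_refl les_trans F (g @: F)).
- by move=> x; exact: imset_f.
- by move=> x y /levP/(_ e).
(* An image containing 0 is a cone. Otherwise it is a single sign, since elimination between
   opposite signs would produce 0. *)
- have [nF|nF] := boolP (szero \in g @: F).
    by apply: (fcontr_cone R les_refl nF) => s _.
  have gF : g x0 \in g @: F by exact: imset_f.
  apply: (fcontr_cone R les_refl gF) => _ /imsetP[x xF ->].
  have [->|ne] := eqVneq (g x0) (g x); first by rewrite /compar les_refl.
  exfalso; have xN : x \in N by move: xF; rewrite inE => /andP[].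
  have esep : e \in sepset (phi x0) (phi x).
    rewrite inE; move: nF ne gF (imset_f g xF); rewrite ffunE /g.
    by case: (phi x0 e) (phi x e) => [[]|] [[]|] //= h1 h2 h3 h4; rewrite ?(negPf h1)// in h3 h4 *.
  have [z [zN ze zf]] := Nelim x0N xN esep.
  move/negP: nF; apply; apply/imsetP; exists z => //; rewrite inE zN /=.
  apply/andP; split.
    (* At a separated coordinate [Z] is 0, being below both opposite signs. *)
    apply/levP => f; have /levP/(_ f) := Zx0; move: xF; rewrite inE => /and3P[_ /levP/(_ f)].
    have [fs|fs] := boolP (f \in sepset (phi x0) (phi x)); last first.
      by rewrite zf// ffunE /les; case: (Z f) (phi x0 f) (phi x f) => [[]|] [[]|] [[]|].
    move: fs; rewrite inE ffunE /les.
    by case: (Z f) (phi x0 f) (phi x f) => [[]|] [[]|] [[]|].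
  apply/forall_inP => a aA; rewrite zf; last first.
    by rewrite inE ffunE (Fe x xF a aA); case: (phi x0 a) => [[]|].
  by rewrite ffunE (Fe x xF a aA); case: (phi x0 a).
- move=> b /imsetP[y yF ->]; apply: fiber_contr => //; first exact: les_refl.
    have yN : y \in N by move: yF; rewrite inE => /andP[].
    have Zy : lev Z (phi y) by move: yF; rewrite inE => /and3P[].
    have := IHe Z y yN Zy; congr fcontr; apply/setP => w; rewrite !inE -!andbA.
    congr [&& _, _ & _]; apply/forall_inP/andP => [h|[/forall_inP h we] a].
      split; last by apply: h; rewrite !inE eqxx.
      by apply/forall_inP => a aA; rewrite -(Fe y)//; apply: h; rewrite !inE aA orbT.
    by rewrite !inE => /orP[/eqP->//|aA]; rewrite (Fe y)//; exact: h.
  by move=> x xF xb; exact: (up x (g y) y).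
Qed.

End Convexity.

(** The sign of [b - a]. *)
Definition cmpn (a b : nat) : sign := if a < b then spos else if b < a then sneg else szero.

Lemma cmpn_pos a b : (cmpn a b == spos) = (a < b).
Proof. by rewrite /cmpn; case: ltngtP. Qed.

Lemma cmpn_neg a b : (cmpn a b == sneg) = (b < a).
Proof. by rewrite /cmpn; case: ltngtP. Qed.

Lemma cmpn_zero a b : (cmpn a b == szero) = (a == b).
Proof. by rewrite /cmpn; case: ltngtP. Qed.

Lemma cmpn_opp a b : cmpn b a = omap negb (cmpn a b).
Proof. by rewrite /cmpn; case: ltngtP. Qed.

(** * Ordered partitions through relative positions *)

Section OrdParts.
Variable n : nat.
Implicit Types (I J : ordpart n) (a b : 'I_n).

(** The sweep vector extended antisymmetrically to all ordered pairs. *)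
Definition sg I a b : sign := cmpn (block_index I a) (block_index I b).

Lemma sweep_vecE I e : sweep_vec I e = sg I (val e).1 (val e).2.
Proof. by rewrite ffunE. Qed.

Definition leO I J := lev (sweep_vec I) (sweep_vec J).

Lemma sg_opp I a b : sg I b a = omap negb (sg I a b).
Proof. exact: cmpn_opp. Qed.

Lemma pairsP (p : 'I_n -> 'I_n -> Prop) :
  (forall a, p a a) -> (forall a b, p a b -> p b a) ->
  (forall e : pairs n, p (val e).1 (val e).2) -> forall a b, p a b.
Proof.
move=> pr ps pe a b; have [ab|ba|/val_inj->//] := ltngtP a b.
  exact: (pe (exist _ (a, b) ab)).
by apply: ps; exact: (pe (exist _ (b, a) ba)).
Qed.

Lemma leOP I J : reflect (forall a b, les (sg I a b) (sg J a b)) (leO I J).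
Proof.
apply: (iffP (levP _ _)) => [h|h e]; last by rewrite !sweep_vecE.
apply: pairsP => [a|a b|e]; first by rewrite /sg /cmpn ltnn.
  by rewrite (sg_opp I a b) (sg_opp J a b); case: (sg I a b) (sg J a b) => [[]|] [[]|].
by have := h e; rewrite !sweep_vecE.
Qed.

(** The blocks are the level sets of [r] in increasing order; gaps between the values of [r] are
    harmless. *)
Lemma mk_ordpart (r : 'I_n -> nat) : exists I, forall a b, sg I a b = cmpn (r a) (r b).
Proof.
pose ks := sort leq (undup [seq r a | a <- enum 'I_n]).
have ks_r a : r a \in ks by rewrite mem_sort mem_undup map_f// mem_enum.
have ks_nz k : k \in ks -> exists a, r a = k.
  by rewrite mem_sort mem_undup => /mapP[a _ ->]; exists a.
have ks_sorted : sorted ltn ks.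
  by rewrite ltn_sorted_uniq_leq sort_uniq undup_uniq sort_sorted//; exact: leq_total.
pose F k : {set 'I_n} := [set a | r a == k].
have F_inj : {in ks &, injective F}.
  by move=> k k' /ks_nz[a <-] _ /setP/(_ a); rewrite !inE eqxx => /esym/eqP.
have sz : size (map F ks) <= n.
  by rewrite size_map size_sort (leq_trans (size_undup _))// size_map size_enum_ord.
have part : uniq (Bseq sz) && finset.partition [set:: Bseq sz] [set: 'I_n].
  rewrite /= map_inj_in_uniq// sort_uniq undup_uniq /=; apply/and3P; split.
  - apply/eqP/setP => a; rewrite inE; apply/bigcupP; exists (F (r a)).
      by rewrite inE map_f.
    by rewrite inE.
  - apply/finset.trivIsetP => _ _ /[!inE] /mapP[k _ ->] /mapP[k' _ ->] kk'.
    apply/pred0P => a /=; rewrite !inE; apply: contraNF kk' => /andP[/eqP<- /eqP<-].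
    by [].
  - rewrite inE; apply/mapP => -[k /ks_nz[a <-]] /setP/(_ a).
    by rewrite !inE eqxx.
exists (exist _ (Bseq sz) part) => a b.
have bi c : block_index (exist _ (Bseq sz) part) c = (index (r c) ks).+1.
  by rewrite /block_index /blocks /= find_map; congr _.+1; apply: eq_find => k; rewrite /= inE eq_sym.
rewrite /sg !bi /cmpn !ltnS.
have mono x y : x \in ks -> y \in ks -> (index x ks < index y ks) = (x < y).
  move=> xks yks; apply/idP/idP => h.
    by apply: (sorted_ltn_index ltn_trans ks_sorted).
  have [//|yx|/(congr1 (nth 0 ks))] := ltngtP (index x ks) (index y ks).
    have /= := sorted_ltn_index ltn_trans ks_sorted _ _ yks xks yx.
    by rewrite ltnNge ltnW.
  by rewrite !nth_index// => xy; move: h; rewrite xy ltnn.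
by rewrite !mono.
Qed.

Lemma block_indexP I a : (block_index I a).-1 < size (blocks I) /\
  a \in nth finset.set0 (blocks I) (block_index I a).-1.
Proof.
have h : has (fun B : {set 'I_n} => a \in B) (blocks I).
  have /andP[_ /and3P[/eqP/setP/(_ a)]] := valP I.
  rewrite inE => /bigcupP[B]; rewrite inE => BI aB _ _.
  by apply/hasP; exists B.
by rewrite /block_index /= -has_find; split => //; exact: (nth_find _ h).
Qed.

Lemma block_nonempty I B : B \in blocks I -> exists a, a \in B.
Proof.
move=> BI; have /andP[_ /and3P[_ _]] := valP I.
by rewrite inE => h; apply/set0Pn; apply: contraNneq h => <-.
Qed.

Lemma mem_block I i a : i < size (blocks I) ->
  (a \in nth finset.set0 (blocks I) i) = (block_index I a == i.+1).
Proof.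
move=> ilt; have /andP[u /and3P[_ tr _]] := valP I.
have [jlt aj] := block_indexP I a; apply/idP/eqP => [ai|e]; last by rewrite e in aj.
rewrite -[block_index I a]prednK//; congr _.+1; apply/eqP.
rewrite -(nth_uniq finset.set0 jlt ilt u); apply: contraTT ai => ne.
have /finset.trivIsetP/(_ _ _ _ _ ne) := tr.
rewrite !inE !mem_nth// => /(_ isT isT) /pred0P/(_ a) /=.
by rewrite aj /= => ->.
Qed.

End OrdParts.

Section KeySort.
Variables (T : Type) (q : T -> nat).

Lemma filter_key_cat m s : sorted (relpre q leq) s ->
  [seq x <- s | q x < m] ++ [seq x <- s | m <= q x] = s.
Proof.
elim: s => //= x s IH xs; have tr : transitive (relpre q leq).
  by move=> a b c; exact: leq_trans.
have [xm|mx] := ltnP (q x) m; first by rewrite /= IH//; exact: path_sorted xs.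
have := order_path_min tr xs => /all_filterP al.
have h : all (fun y => m <= q y) s.
  by apply: sub_all (order_path_min tr xs) => y; exact: leq_trans.
rewrite (_ : [seq _ <- _ | _] = [::]) /= ?(all_filterP h)//.
by elim: s h {IH xs al} => //= y s IH /andP[my /IH->]; rewrite ltnNge my.
Qed.

(** Grouping by key keeps the order of a sequence sorted by key. This provides the groups of blocks
    in [refinesP]. *)
Lemma flatten_key m s : sorted (relpre q leq) s -> all (fun x => q x < m) s ->
  flatten [seq [seq x <- s | q x == i] | i <- iota 0 m] = s.
Proof.
elim: m s => [|m IH] s ss; first by case: s ss => //= x s.
move=> sm; rewrite -addn1 iotaD map_cat flatten_cat /= cats0 add0n.
rewrite -[RHS](filter_key_cat m ss); congr (_ ++ _); last first.
  elim: s sm {ss} => //= x s IHs /andP[xm /IHs->].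
  by rewrite eqn_leq -ltnS xm.
rewrite -[RHS]IH.
- congr flatten; apply/eq_in_map => i; rewrite mem_iota /= => im.
  rewrite -filter_predI; apply: eq_filter => x /=.
  by case: eqP => //= ->.
- by apply: sorted_filter => // a b c; exact: leq_trans.
- exact: filter_all.
Qed.

End KeySort.

(** * Refinement is the covector order *)

Section Refinement.
Variable n : nat.
Implicit Types (I J : ordpart n) (a b c : 'I_n).

Lemma sg_pos I a b : (sg I a b == spos) = (block_index I a < block_index I b).
Proof. exact: cmpn_pos. Qed.

Lemma sg_neg I a b : (sg I a b == sneg) = (block_index I b < block_index I a).
Proof. exact: cmpn_neg. Qed.

Lemma sg_zero I a b : (sg I a b == szero) = (block_index I a == block_index I b).
Proof. exact: cmpn_zero. Qed.

Lemma in_bigcup_seq (T : finType) (s : seq {set T}) (a : T) :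
  (a \in \bigcup_(C <- s) C) = has (fun C : {set T} => a \in C) s.
Proof. by elim: s => [|C s IH]; rewrite ?big_nil ?big_cons inE//= IH. Qed.

Lemma find_flatten (T : finType) (ss : seq (seq {set T})) (a b : T) :
  find (fun B : {set T} => a \in B) [seq \bigcup_(C <- s) C | s <- ss] <
  find (fun B : {set T} => b \in B) [seq \bigcup_(C <- s) C | s <- ss] ->
  find (fun B : {set T} => a \in B) (flatten ss) <
  find (fun B : {set T} => b \in B) (flatten ss).
Proof.
elim: ss => //= s ss IH; rewrite !in_bigcup_seq !find_cat.
case: ifP => ha; case: ifP => hb //.
  by move: ha; rewrite has_find => ha _; apply: leq_trans ha _; exact: leq_addr.
by rewrite ltnS => /IH; rewrite ltn_add2l.
Qed.

(** Merging consecutive blocks only turns strict relations into ties. Conversely, if [leO I J], each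
    block of [J] lies in one block of [I], whose index [q] is weakly increasing along [J]; grouping
    by [q] recovers [I]. *)
Lemma refinesP J I : refines J I <-> leO I J.
Proof.
split=> [[ss [eJ eI]]|IJ].
  have mono a b : block_index I a < block_index I b -> block_index J a < block_index J b.
    by rewrite /block_index eI eJ !ltnS; exact: find_flatten.
  apply/leOP => a b; rewrite /les /sg /cmpn.
  case: ltngtP => // /mono; first by move=> ->.
  by move=> h; rewrite ltnNge (ltnW h) h.
have sgle a b : les (sg I a b) (sg J a b) by move/leOP: IJ.
have le_mono a b : block_index J a <= block_index J b -> block_index I a <= block_index I b.
  rewrite leqNgt -sg_neg [block_index I a <= _]leqNgt -sg_neg; apply: contra => /eqP e.
  by have := sgle a b; rewrite /les e /= eq_sym.
pose q (C : {set 'I_n}) := find (fun B : {set 'I_n} => C \subset B) (blocks I).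
have nthJ i a : i < size (blocks J) -> a \in nth finset.set0 (blocks J) i ->
    q (nth finset.set0 (blocks J) i) = (block_index I a).-1.
  move=> iJ aC; rewrite /q /block_index /=; apply: eq_in_find => B /(nthP finset.set0)[k kI <-].
  apply/fintype.subsetP/idP => [/(_ a aC)//|]; rewrite mem_block// => /eqP pa b.
  rewrite mem_block// => /eqP pb; rewrite mem_block//; move: aC; rewrite mem_block// => /eqP pJa.
  by rewrite -pa eqn_leq !le_mono ?pJa ?pb.
have exJ i : i < size (blocks J) -> exists a, a \in nth finset.set0 (blocks J) i.
  by move=> iJ; apply: (@block_nonempty _ J); exact: mem_nth.
have qs : sorted (relpre q leq) (blocks J).
  apply/(sortedP finset.set0) => i iJ /=; have iJ' := ltnW iJ.
  have [a aC] := exJ i iJ'; have [b bC] := exJ i.+1 iJ.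
  rewrite (nthJ i a)// (nthJ i.+1 b)//; move: aC bC; rewrite !mem_block// => /eqP pa /eqP pb.
  have := le_mono a b; rewrite pa pb leqnSn => /(_ isT); lia.
have qlt : all (fun C => q C < size (blocks I)) (blocks J).
  apply/(all_nthP finset.set0) => i iJ; have [a aC] := exJ i iJ; rewrite (nthJ i a)//.
  by have [] := block_indexP I a.
exists [seq [seq C <- blocks J | q C == i] | i <- iota 0 (size (blocks I))].
split; first by rewrite flatten_key.
apply: (@eq_from_nth _ finset.set0); first by rewrite !size_map size_iota.
move=> i iI; rewrite -map_comp (nth_map 0) ?size_iota// nth_iota//= add0n.
apply/setP => a; rewrite in_bigcup_seq mem_block//; apply/eqP/hasP => [pa|].
  have [jJ aj] := block_indexP J a; exists (nth finset.set0 (blocks J) (block_index J a).-1) => //.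
  by rewrite mem_filter mem_nth// (nthJ _ a)// pa eqxx.
move=> [C]; rewrite mem_filter => /andP[/eqP qC /(nthP finset.set0)[j jJ jC]] aC.
by move: qC; rewrite -jC (nthJ _ a) ?jC// => <-; rewrite prednK.
Qed.

Lemma leO_refl : reflexive (@leO n).
Proof. by move=> I; exact: lev_refl. Qed.

Lemma leO_trans : transitive (@leO n).
Proof. by move=> I J K; exact: lev_trans. Qed.

End Refinement.

(** * Composition and elimination in the little oriented matroid *)

Section LittleOM.
Variables (n : nat) (M : {set {ffun pairs n -> sign}}).
Hypothesis hM : sweep_oriented_matroid M.
Implicit Types (I J K : ordpart n) (a b c e : 'I_n) (U V : {ffun 'I_n -> sign}).

(** A description of the level vectors of [I] without the parameter [k]: the zero set is empty or a
    block, with negative elements before and positive ones after. *)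
Definition compatible I U :=
  (forall a b, U a = szero -> U b = sg I a b) /\
  (forall a b, U a = sneg -> U b = spos -> sg I a b = spos).

Definition sgrow I c : {ffun 'I_n -> sign} := [ffun a => sg I c a].

Lemma block_index_le I a : block_index I a <= size (blocks I).
Proof. by have [] := block_indexP I a. Qed.

Lemma little_omP U : reflect (exists2 I, sweep_vec I \in M & compatible I U)
  (U \in little_om M).
Proof.
apply: (iffP imsetP) => [[Y]|[I IM [c0 c1]]].
  rewrite inE => /existsP[I /andP[IM /existsP[k /andP[k0 /eqP ->]]]] ->.
  exists I => //; split=> a b; rewrite !ffunE; have := block_indexP I a.
    case: ifP => // h1; case: ifP => // h2 _ _.
    have pa : nat_of_ord k = (block_index I a).*2 by lia.
    by rewrite /sg /cmpn pa; case: ltngtP => h; do ?[case: ifP => ?] => //; lia.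
  case: ifP => h1; last by case: ifP.
  by case: ifP => h2 //; case: ifP => h3 // _ _ _; apply/eqP; rewrite sg_pos; lia.
have [/existsP[z /eqP Uz]|/existsPn nz] := boolP [exists z, U z == szero].
  have kl : (block_index I z).*2 < (2 * size (blocks I)).+2.
    by have := block_index_le I z; lia.
  exists (level_vec I (Ordinal kl)).
    rewrite inE; apply/existsP; exists I; rewrite IM /=; apply/existsP; exists (Ordinal kl).
    by rewrite eqxx andbT.
  apply/ffunP => a; rewrite !ffunE (c0 z a Uz) /sg /cmpn.
  rewrite (_ : nat_of_ord (Ordinal kl) = (block_index I z).*2)//.
  have pz : 0 < block_index I z by [].
  by case: ltngtP => h; do ?[case: ifP => ?] => //; lia.
(* Without zeros, [k] is 2m + 1 with [m] the last block containing a negative element, or 0 if there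
   is none; with a zero [z], [k] was twice its block index. *)
pose m := \max_(a | U a == sneg) block_index I a.
have kl : m.*2.+1 < (2 * size (blocks I)).+2.
  suff : m <= size (blocks I) by lia.
  by apply/bigmax_leqP => a _; exact: block_index_le.
exists (level_vec I (Ordinal kl)).
  rewrite inE; apply/existsP; exists I; rewrite IM /=; apply/existsP; exists (Ordinal kl).
  by rewrite eqxx andbT.
apply/ffunP => a; rewrite !ffunE /= doubleK uphalf_double.
case Ua : (U a) (nz a) => [[]|]// _; last first.
  by rewrite (_ : _ <= _)//; apply: (leq_bigmax_cond (F := block_index I)); rewrite Ua.
suff ma : m < block_index I a by rewrite ma leqNgt ma.
suff : m <= (block_index I a).-1 by have : 0 < block_index I a by []; lia.
apply/bigmax_leqP => b /eqP Ub; have /eqP := c1 b a Ub Ua.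
by rewrite sg_pos; case: (block_index I a).
Qed.

Lemma row_little I c : sweep_vec I \in M -> sgrow I c \in little_om M.
Proof.
move=> IM; apply/little_omP; exists I => //; split=> a b; rewrite !ffunE => /eqP.
  by rewrite sg_zero /sg => /eqP->.
rewrite sg_neg => h /eqP; rewrite sg_pos => h'; apply/eqP; rewrite sg_pos; lia.
Qed.

Lemma compatible_row I U c : compatible I U -> U c = szero -> U = sgrow I c.
Proof. by move=> [c0 _] Uc; apply/ffunP => a; rewrite ffunE; exact: c0. Qed.

Definition cs (s t : sign) : sign := if s != szero then s else t.

Lemma sweep_zero : exists2 K, sweep_vec K \in M & forall a b, sg K a b = szero.
Proof.
have [[M0 _ _ _] hI] := hM; have [K eK] := hI _ M0; exists K; first by rewrite -eK.
apply: pairsP => [a|a b|e]; first by apply/eqP; rewrite sg_zero.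
  by rewrite (sg_opp K a b) => ->.
by rewrite -sweep_vecE -eK ffunE.
Qed.

Lemma sweep_comp I J : sweep_vec I \in M -> sweep_vec J \in M ->
  exists K, [/\ sweep_vec K \in M, sweep_vec K = compv (sweep_vec I) (sweep_vec J)
    & forall a b, sg K a b = cs (sg I a b) (sg J a b)].
Proof.
move=> IM JM; have [[_ _ Mc _] hI] := hM; have cM := Mc _ _ IM JM.
have [K eK] := hI _ cM; exists K; split; rewrite -?eK//.
apply: pairsP => [a|a b|e].
- by rewrite /sg /cmpn !ltnn.
- rewrite (sg_opp K a b) (sg_opp I a b) (sg_opp J a b) => ->.
  by case: (sg I a b) => [[]|].
- by rewrite -!sweep_vecE -eK ffunE.
Qed.

Definition seps (s t : sign) := (s != szero) && (t == omap negb s).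

Lemma sweep_elim I J a b : sweep_vec I \in M -> sweep_vec J \in M ->
  seps (sg I a b) (sg J a b) ->
  exists K, [/\ sweep_vec K \in M, sg K a b = szero &
    forall c d, ~~ seps (sg I c d) (sg J c d) -> sg K c d = cs (sg I c d) (sg J c d)].
Proof.
move=> IM JM; have [[_ _ _ Me] hI] := hM; move: a b.
have sepE (e : pairs n) : (e \in sepset (sweep_vec I) (sweep_vec J)) =
    seps (sg I (val e).1 (val e).2) (sg J (val e).1 (val e).2).
  by rewrite inE !sweep_vecE ffunE sweep_vecE.
apply: pairsP => [a|a b IH|e].
- by rewrite /sg /cmpn ltnn.
- rewrite (sg_opp I a b) (sg_opp J a b) => h.
  have /IH[K [KM Kab Ke]] : seps (sg I a b) (sg J a b).
    by move: h; case: (sg I a b) (sg J a b) => [[]|] [[]|].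
  by exists K; rewrite sg_opp Kab.
- rewrite -sepE => /(Me _ _ _ IM JM)[Z [ZM Ze Zf]].
  have [K eK] := hI _ ZM; exists K; rewrite -eK -sweep_vecE -eK; split => //.
  apply: pairsP => [c|c d|f].
  + by rewrite /sg /cmpn !ltnn.
  + rewrite (sg_opp K c d) (sg_opp I c d) (sg_opp J c d) => IH h.
    rewrite IH; first by case: (sg I c d) => [[]|].
    by move: h; case: (sg I c d) (sg J c d) => [[]|] [[]|].
  + by rewrite -sepE => /Zf; rewrite eK sweep_vecE => ->; rewrite ffunE !sweep_vecE.
Qed.

(** The linear order with [szero] between [sneg] and [spos], as opposed to the order on
    covectors. *)
Definition lts (s t : sign) :=
  match s, t with
  | Some false, (None | Some true) | None, Some true => true
  | _, _ => false
  end.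

Lemma compatible_lt I U a b : compatible I U -> lts (U a) (U b) -> sg I a b = spos.
Proof.
move=> [c0 c1]; case Ua : (U a) => [[]|]; case Ub : (U b) => [[]|] //= _.
- exact: c1.
- by have := c0 _ a Ub; rewrite Ua sg_opp; case: (sg I a b) => [[]|].
- by rewrite -(c0 a b Ua).
Qed.

Lemma compatible_eq I U a b : compatible I U -> U a = szero -> U b = szero ->
  sg I a b = szero.
Proof. by move=> [c0 _] Ua Ub; rewrite -(c0 a b Ua). Qed.

(** The composition of the two sweeps is a witness: [I] orders pairs with different signs in [U],
    while common zeros of [U] are tied in [I] and ordered by [J]. *)
Lemma little_comp U V : U \in little_om M -> V \in little_om M ->
  compv U V \in little_om M.
Proof.
move=> /little_omP[I IM cI] /little_omP[J JM cJ].
have [K [KM _ eK]] := sweep_comp IM JM; apply/little_omP; exists K => //.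
split=> a b; rewrite !ffunE eK.
  case Ua : (U a) => [[]|] //= Va.
  by case: cI cJ => [cI _] [cJ _]; rewrite (cI a b Ua) (cJ a b Va).
move=> Wa Wb.
suff [->//|[-> Vab]] : sg I a b = spos \/ (sg I a b = szero /\ lts (V a) (V b)).
  by rewrite (compatible_lt cJ Vab).
move: Wa Wb; case Ua : (U a) => [[]|]; case Ub : (U b) => [[]|] //=.
- by left; apply: (compatible_lt cI); rewrite Ua Ub.
- by left; apply: (compatible_lt cI); rewrite Ua Ub.
- by left; apply: (compatible_lt cI); rewrite Ua Ub.
- by move=> -> ->; right; split => //; exact: (compatible_eq cI).
Qed.

Lemma little_const (s : sign) : [ffun=> s] \in little_om M.
Proof.
have [K KM K0] := sweep_zero; apply/little_omP; exists K => //.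
by split=> a b; rewrite !ffunE K0//; move=> ->.
Qed.

(* If b in B is not above e in I, eliminating (e, b) between I and J puts b  *)
(* at the level of e, and the elements of A stay below it since A < b.       *)
Lemma sweep_between (A B : pred 'I_n) e I J : sweep_vec I \in M -> sweep_vec J \in M ->
  (forall a b, A a -> B b -> sg I a b = spos /\ sg J a b = spos) ->
  (forall a, A a -> sg I a e = spos) -> (forall b, B b -> sg J e b = spos) ->
  exists K, [/\ sweep_vec K \in M, forall a, A a -> sg K a e = spos &
    forall b, B b -> sg K e b = spos].
Proof.
move=> + JM; have [m] := ubnP #|[set b | B b && (sg I e b != spos)]|.
elim: m I => // m IH I; rewrite ltnS => Im IM AB Ae Be.
have [/existsP[b /andP[Bb eb]]|/existsPn all] := boolP [exists b, B b && (sg I e b != spos)]; last first.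
  exists I; split => // b Bb; have := all b; rewrite Bb /= negbK => /eqP; exact.
suff [K [KM Keb KAB KB]] : exists K, [/\ sweep_vec K \in M, sg K e b = szero,
    forall a b', A a -> B b' -> sg K a b' = spos &
    forall b', B b' -> sg I e b' = spos -> sg K e b' = spos].
  have [L [LM _ eL]] := sweep_comp KM JM; apply: (IH L) => //.
  - apply: leq_trans Im; apply: proper_card; apply/properP; split.
      apply/fintype.subsetP => b'; rewrite !inE => /andP[Bb'].
      rewrite Bb' eL /=; apply: contraNneq => /(KB _ Bb')->.
      by [].
    exists b; rewrite inE Bb//= eL Keb Be//.
  - by move=> a b' Aa Bb'; rewrite eL KAB//; split => //; case: (AB a b').
  - move=> a Aa; rewrite eL; have /eqP := KAB a b Aa Bb; move/eqP: Keb.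
    by rewrite sg_pos sg_zero => /eqP<-; rewrite -sg_pos => /eqP->.
have [eb0|ebn] := eqVneq (sg I e b) szero.
  by exists I; split => // a b' Aa Bb'; case: (AB a b').
have [|K [KM Keb Ke]] := @sweep_elim I J e b IM JM.
  by rewrite Be//; move: eb ebn; case: (sg I e b) => [[]|].
exists K; split => //.
- by move=> a b' Aa Bb'; have [Iab Jab] := AB a b' Aa Bb'; rewrite Ke Iab ?Jab.
- by move=> b' Bb' Ieb'; rewrite Ke Ieb' ?Be.
Qed.

(** If [U] and [V] have a common zero [z], they are rows at [z] and the pair of [z] and [e] is
    eliminated between the sweeps. Otherwise all prescribed signs are nonzero, and a sweep is needed
    with the prescribed negatives before [e] and positives after; its row at [e] is the answer. *)
Lemma little_elim_pos U V e : U \in little_om M -> V \in little_om M ->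
  U e = spos -> V e = sneg ->
  exists Z, [/\ Z \in little_om M, Z e = szero &
    forall a, a \notin sepset U V -> Z a = compv U V a].
Proof.
move=> /little_omP[I IM cI] /little_omP[J JM cJ] Ue Ve.
have sepE a : (a \in sepset U V) = seps (U a) (V a) by rewrite inE ffunE.
have [/existsP[z /andP[/eqP Uz /eqP Vz]]|/existsPn nz] :=
    boolP [exists z, (U z == szero) && (V z == szero)].
  have [cI0 _] := cI; have [cJ0 _] := cJ.
  have [|K [KM Kze Ke]] := @sweep_elim I J z e IM JM.
    by rewrite -(cI0 z e Uz) -(cJ0 z e Vz) Ue Ve.
  exists (sgrow K z); split; [exact: row_little|by rewrite ffunE|] => a.
  by rewrite sepE !ffunE (cI0 z a Uz) (cJ0 z a Vz) => /Ke.
(* Composing in both orders breaks ties: both sweeps then put [A] before [B], [I1] puts [A] before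
   [e], and [J1] puts [e] before [B]. *)
have [I1 [I1M _ eI1]] := sweep_comp IM JM.
have [J1 [J1M _ eJ1]] := sweep_comp JM IM.
pose A a := (a \notin sepset U V) && (compv U V a == sneg).
pose B a := (a \notin sepset U V) && (compv U V a == spos).
have AP a : A a -> (U a = sneg /\ les (V a) sneg) \/ (U a = szero /\ V a = sneg).
  rewrite /A sepE !ffunE; case: (U a) (V a) => [[]|] [[]|] //=; by auto.
have BP a : B a -> (U a = spos /\ les (V a) spos) \/ (U a = szero /\ V a = spos).
  rewrite /B sepE !ffunE; case: (U a) (V a) => [[]|] [[]|] //=; by auto.
have les_case (s t : sign) : les s t -> s = szero \/ s = t.
  by rewrite /les => /orP[/eqP|/eqP]; auto.
have AB a b : A a -> B b -> sg I1 a b = spos /\ sg J1 a b = spos.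
  move=> /AP Aa /BP Bb; rewrite eI1 eJ1.
  have ltI : lts (U a) (U b) -> sg I a b = spos by exact: compatible_lt.
  have ltJ : lts (V a) (V b) -> sg J a b = spos by exact: compatible_lt.
  have eqI : U a = szero -> U b = szero -> sg I a b = szero by exact: compatible_eq.
  have eqJ : V a = szero -> V b = szero -> sg J a b = szero by exact: compatible_eq.
  move: Aa Bb ltI ltJ eqI eqJ.
  by move=> [[-> /les_case[]->]|[-> ->]] [[-> /les_case[]->]|[-> ->]] ltI ltJ eqI eqJ;
    rewrite ?(ltI isT) ?(ltJ isT) ?(eqI erefl erefl) ?(eqJ erefl erefl) ?(ltI isT) ?(ltJ isT).
have Ae a : A a -> sg I1 a e = spos.
  by move=> /AP[[Ua _]|[Ua _]]; rewrite eI1 (@compatible_lt I U)// Ua Ue.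
have Be b : B b -> sg J1 e b = spos.
  by move=> /BP[[_ /les_case[]Vb]|[_ Vb]]; rewrite eJ1 (@compatible_lt J V)// Vb Ve.
have [K [KM KA KB]] := sweep_between I1M J1M AB Ae Be.
exists (sgrow K e); split; [exact: row_little|by apply/eqP; rewrite ffunE sg_zero|] => a asep.
rewrite ffunE; case W : (compv U V a) => [[]|].
- by rewrite KB// /B asep W.
- by rewrite sg_opp KA// /A asep W.
- exfalso; move: W (nz a); rewrite ffunE; case: (U a) (V a) => [[]|] [[]|] //.
Qed.

Lemma little_elim U V e : U \in little_om M -> V \in little_om M ->
  e \in sepset U V ->
  exists Z, [/\ Z \in little_om M, Z e = szero &
    forall a, a \notin sepset U V -> Z a = compv U V a].
Proof.
move=> UL VL; rewrite inE ffunE => sep.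
have sepC a : (a \in sepset V U) = (a \in sepset U V).
  by rewrite !inE !ffunE; case: (U a) (V a) => [[]|] [[]|].
case Ue : (U e) sep => [[]|] //= /eqP Ve; first exact: little_elim_pos.
have [Z [ZL Ze Za]] := little_elim_pos VL UL Ve Ue.
exists Z; split => // a asep; rewrite Za ?sepC//.
by move: asep; rewrite inE !ffunE; case: (U a) (V a) => [[]|] [[]|].
Qed.

End LittleOM.

(** * Pseudo-sweeps *)

Section Strings.
Variables (n : nat) (M : {set {ffun pairs n -> sign}}).
Hypothesis hM : sweep_oriented_matroid M.
Implicit Types (I J K : ordpart n) (a b c e : 'I_n) (X : {ffun 'I_n -> sign}).
Implicit Types (D : {set 'I_n}) (T : {ffun 'I_n -> sign}).

Let L := little_om M.

Let comp_L X Y : X \in L -> Y \in L -> compv X Y \in L.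
Proof. exact: little_comp. Qed.

(** Two topes that differ exactly on [D]; in passing from [T1] to [T2] the elements of [D] turn from
    positive to negative. *)
Definition crossing D T1 T2 := [/\ T1 \in L, T2 \in L,
  forall a, a \in D -> T1 a = spos /\ T2 a = sneg &
  forall a, a \notin D -> T1 a = T2 a /\ T1 a != szero].

Definition fill D T (r : 'I_n -> nat) c : {ffun 'I_n -> sign} :=
  [ffun a => if a \in D then cmpn (r c) (r a) else T a].

Let neg_part D X : {set 'I_n} := [set a in D | X a == sneg].
Let pos_part D X : {set 'I_n} := [set a in D | X a == spos].

(** An intermediate covector [X] splits the passage: its negative elements have been passed, its
    zeros are passed simultaneously, its positive ones remain. *)
Lemma crossing_halves D T1 T2 X : crossing D T1 T2 -> X \in L ->
  (forall a, a \notin D -> X a = T1 a) ->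
  crossing (neg_part D X) T1 (compv X T1) /\ crossing (pos_part D X) (compv X T2) T2.
Proof.
move=> [L1 L2 inD outD] XL XT; split; split => //; try exact: comp_L.
- by move=> a; rewrite inE => /andP[/inD[-> _] /eqP Xa]; rewrite ffunE Xa.
- move=> a; rewrite inE ffunE; have [/inD[-> _] /=|/[dup] /XT -> /outD[_ h] _] := boolP (a \in D).
    by case: (X a) => [[]|].
  by rewrite h.
- by move=> a; rewrite inE => /andP[/inD[_ ->] /eqP Xa]; rewrite ffunE Xa.
- move=> a; rewrite inE ffunE; have [/inD[_ ->] /=|/[dup] /XT -> /outD[<- h] _] := boolP (a \in D).
    by case: (X a) => [[]|].
  by rewrite h.
Qed.

(** Elements passed before [X] keep their ranks below [N], the zeros of [X] get rank [N], and the
    others are shifted beyond [N]. *)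
Lemma glue_ranks D T1 T2 X r1 r2 : crossing D T1 T2 -> X \in L ->
  (forall a, a \notin D -> X a = T1 a) ->
  (forall c, c \in neg_part D X -> fill (neg_part D X) T1 r1 c \in L) ->
  (forall c, c \in pos_part D X -> fill (pos_part D X) (compv X T2) r2 c \in L) ->
  exists r, (forall c, c \in D -> fill D T1 r c \in L) /\
    (forall e, e \in D -> X e = szero -> fill D T1 r e = X).
Proof.
move=> [L1 L2 inD outD] XL XT h1 h2.
pose N := (\max_a r1 a).+1.
have r1N a : r1 a < N by rewrite ltnS; exact: leq_bigmax.
exists (fun a => if X a == sneg then r1 a else if X a == szero then N else N.+1 + r2 a).
have fillX c : c \in D -> X c = szero -> fill D T1 (fun a =>
    if X a == sneg then r1 a else if X a == szero then N else N.+1 + r2 a) c = X.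
  move=> cD Xc; apply/ffunP => a; rewrite ffunE; case: ifPn => [aD|/XT->//].
  rewrite Xc /cmpn /=; have := r1N a; case: (X a) => [[]|] //= ra; do ?[case: ifP => ?] => //; lia.
split => // c cD; case Xc : (X c) => [[]|]; last by rewrite fillX.
- have cp : c \in pos_part D X by rewrite inE cD Xc.
  rewrite (_ : fill _ _ _ c = fill (pos_part D X) (compv X T2) r2 c); first exact: h2.
  apply/ffunP => a; rewrite !ffunE inE.
  have [aD|aD] /= := boolP (a \in D); last first.
    by rewrite XT//; have [_ ->] := outD a aD.
  rewrite Xc /cmpn /=; have := r1N a; have [_ ->] := inD a aD.
  case: (X a) => [[]|] //= ra; do ?[case: ifP => ?] => //; lia.
- have cn : c \in neg_part D X by rewrite inE cD Xc.
  rewrite (_ : fill _ _ _ c = fill (neg_part D X) T1 r1 c); first exact: h1.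
  apply/ffunP => a; rewrite !ffunE inE.
  have [aD|aD] //= := boolP (a \in D).
  rewrite Xc /cmpn /=; have := r1N a; have := r1N c; have [-> _] := inD a aD.
  case: (X a) => [[]|] //= ra rc; do ?[case: ifP => ?] => //; lia.
Qed.

(** Elimination at some [e] in [D] gives an intermediate covector vanishing at [e], so both halves
    are smaller and induction applies. *)
Lemma crossing_ranks D T1 T2 : crossing D T1 T2 ->
  exists r, forall c, c \in D -> fill D T1 r c \in L.
Proof.
have [m] := ubnP #|D|; elim: m D T1 T2 => // m IH D T1 T2; rewrite ltnS => Dm cr.
have [->|[e eD]] := set_0Vmem D; first by exists (fun=> 0) => c; rewrite inE.
have [L1 L2 inD outD] := cr.
have esep : e \in sepset T1 T2 by rewrite inE ffunE; have [-> ->] := inD e eD.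
have [X [XL Xe Xf]] := little_elim hM L1 L2 esep.
have XT a : a \notin D -> X a = T1 a.
  move=> /outD[e12 n1]; rewrite Xf ?ffunE ?n1// inE ffunE -e12.
  by case: (T1 a) => [[]|].
have [c1 c2] := crossing_halves cr XL XT.
have lt (D' : {set 'I_n}) : D' \subset D -> e \notin D' -> #|D'| < m.
  move=> DD eD'; apply: leq_trans Dm; apply: proper_card; apply/properP; split => //.
  by exists e.
have [r1 h1] : exists r, forall c, c \in neg_part D X -> fill (neg_part D X) T1 r c \in L.
  by apply: IH c1; apply: lt; [apply/fintype.subsetP => a|]; rewrite inE ?Xe ?andbF// => /andP[].
have [r2 h2] : exists r, forall c, c \in pos_part D X -> fill (pos_part D X) (compv X T2) r c \in L.
  by apply: IH c2; apply: lt; [apply/fintype.subsetP => a|]; rewrite inE ?Xe ?andbF// => /andP[].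
by have [r [hr _]] := glue_ranks cr XL XT h1 h2; exists r.
Qed.

Lemma crossing_ranks_through D T1 T2 X : crossing D T1 T2 -> X \in L ->
  (forall a, a \notin D -> X a = T1 a) ->
  exists r, (forall c, c \in D -> fill D T1 r c \in L) /\
    (forall e, e \in D -> X e = szero -> fill D T1 r e = X).
Proof.
move=> cr XL XT; have [c1 c2] := crossing_halves cr XL XT.
have [r1 h1] := crossing_ranks c1; have [r2 h2] := crossing_ranks c2.
exact: glue_ranks cr XL XT h1 h2.
Qed.

Definition pseudo : {set ordpart n} := [set I | [forall c, sgrow I c \in L]].

Lemma pseudoP I : reflect (forall c, sgrow I c \in L) (I \in pseudo).
Proof. by rewrite inE; exact: forallP. Qed.

Lemma sg_across I z e a : sg I z e != szero -> sg I z a != sg I z e ->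
  sg I e a = omap negb (sg I z e).
Proof.
rewrite /sg /cmpn; case: ltngtP => // h1 _; case: ltngtP => h2 // _;
  case: ltngtP => h3 //; lia.
Qed.

(** [D] is the interval of [J0] around [e] cut out by the blocks of elements of [A]. Passing through
    it anew by way of [X], and keeping [J0] outside, changes only rows at elements of [D]. *)
Lemma pseudo_realize (A : {set 'I_n}) J0 e X : J0 \in pseudo -> X \in L ->
  (forall z, z \in A -> sg J0 z e != szero) ->
  X e = szero ->
  (forall a, ~~ [forall z in A, sg J0 z a == sg J0 z e] -> X a = sg J0 e a) ->
  exists J, [/\ J \in pseudo, forall z, z \in A -> sgrow J z = sgrow J0 z & sgrow J e = X].
Proof.
move=> /pseudoP PJ XL Ae Xe.
pose D := [set a | [forall z in A, sg J0 z a == sg J0 z e]].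
move=> XD0; have XD a : a \notin D -> X a = sg J0 e a by rewrite inE; exact: XD0.
have eD : e \in D by rewrite inE; apply/forall_inP.
have sgD a c : a \notin D -> c \in D -> sg J0 c a = sg J0 e a /\ sg J0 e a != szero.
  rewrite !inE => /forall_inPn[z zA za] /forall_inP/(_ z zA)/eqP zc.
  have ze := Ae z zA; rewrite (sg_across ze za) (@sg_across J0 z c a) ?zc//.
  by split=> //; case: (sg J0 z e) ze => [[]|].
(* [c0] and [c1] lie in the first and last blocks of [D]; their rows composed with + and - are the
   topes just before and just after [D]. *)
have [c0 c0D c0min] := @arg_minnP _ e (mem D) (block_index J0) eD.
have [c1 c1D c1max] := @arg_maxnP _ e (mem D) (block_index J0) eD.
have cr : crossing D (compv (sgrow J0 c0) [ffun=> spos]) (compv (sgrow J0 c1) [ffun=> sneg]).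
  split; try by [apply: comp_L; [exact: PJ|exact: little_const]].
  - move=> a aD; have := c0min a aD; have := c1max a aD; rewrite !ffunE /sg /cmpn.
    by move=> /= h1 h2; split; case: ltngtP => //=; lia.
  - move=> a aD; rewrite !ffunE; have [-> ne] := sgD a c0 aD c0D; have [-> _] := sgD a c1 aD c1D.
    by rewrite ne.
have XT a : a \notin D -> X a = compv (sgrow J0 c0) [ffun=> spos] a.
  by move=> aD; rewrite XD// !ffunE; have [-> ->] := sgD a c0 aD c0D.
have [r [rL rX]] := crossing_ranks_through cr XL XT.
(* Elements before [D] get ranks below [N], those of [D] ranks from [N] to below [N'], those after
   [D] ranks beyond [N']. *)
pose N := (size (blocks J0)).+1; pose N' := N + (\max_a r a).+1.
have pN a : block_index J0 a < N by rewrite ltnS block_index_le.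
have rN a : N + r a < N' by rewrite ltn_add2l ltnS; exact: leq_bigmax.
have [J eJ] := mk_ordpart (fun a => if a \in D then N + r a else
  if sg J0 e a == sneg then block_index J0 a else N' + block_index J0 a).
have Jin c a : c \in D -> sg J c a = fill D (compv (sgrow J0 c0) [ffun=> spos]) r c a.
  move=> cD; rewrite ffunE eJ cD; have [aD|aD] := boolP (a \in D).
    by rewrite /cmpn !ltn_add2l.
  rewrite -XT// XD//; have [_] := sgD a c aD cD; have := pN a; have := rN c; rewrite /cmpn.
  by case: (sg J0 e a) => [[]|] //= h1 h2 _; do ?[case: ifP => ?] => //; lia.
have Jout c a : c \notin D -> sg J c a = sg J0 c a.
  move=> cD; have [aD|aD] := boolP (a \in D).
    rewrite sg_opp (Jin a c aD) ffunE (negPf cD) -XT// XD//.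
    by rewrite (sg_opp J0 a c); have [-> _] := sgD c a cD aD.
  rewrite eJ (negPf cD) (negPf aD).
  have [_] := sgD c e cD eD; have [_] := sgD a e aD eD; have := pN a; have := pN c.
  rewrite sg_zero sg_zero !sg_neg /sg /cmpn => h1 h2 h3 h4.
  case: (ltnP (block_index J0 c) (block_index J0 e)) => hc;
  case: (ltnP (block_index J0 a) (block_index J0 e)) => ha;
  by do ?[case: ifP => ?] => //; lia.
exists J; split.
- apply/pseudoP => c; have [cD|cD] := boolP (c \in D).
    rewrite (_ : sgrow J c = fill D (compv (sgrow J0 c0) [ffun=> spos]) r c); first exact: rL.
    by apply/ffunP => a; rewrite ffunE Jin.
  rewrite (_ : sgrow J c = sgrow J0 c); first exact: PJ.
  by apply/ffunP => a; rewrite !ffunE Jout.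
- move=> z zA; have zD : z \notin D.
    apply: contraL (zA) => zD; apply/negP => _; have := Ae z zA.
    move: zD; rewrite inE => /forall_inP/(_ z zA)/eqP <-.
    by rewrite sg_zero eqxx.
  by apply/ffunP => a; rewrite !ffunE Jout.
- rewrite -[RHS](rX e eD Xe); apply/ffunP => a; rewrite -Jin//.
  by rewrite ffunE.
Qed.

(** The lexicographic order: [J] breaks the ties of [I]. *)
Lemma ordpart_comp I J : exists K, forall a b, sg K a b = cs (sg I a b) (sg J a b).
Proof.
pose N := (size (blocks J)).+1.
have pN a : block_index J a < N by rewrite ltnS block_index_le.
have [K eK] := mk_ordpart (fun a => block_index I a * N + block_index J a).
exists K => a b; rewrite eK; have := pN a; have := pN b; rewrite /cs /sg /cmpn.
by case: (ltngtP (block_index I a)) => h h1 h2; do ?[case: ifP => ?] => //; nia.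
Qed.

Lemma pseudo_comp I J : I \in pseudo -> J \in pseudo ->
  exists2 K, K \in pseudo & forall a b, sg K a b = cs (sg I a b) (sg J a b).
Proof.
move=> /pseudoP PI /pseudoP PJ; have [K eK] := ordpart_comp I J; exists K => //.
apply/pseudoP => c; rewrite (_ : sgrow K c = compv (sgrow I c) (sgrow J c)); first exact: comp_L.
by apply/ffunP => a; rewrite !ffunE eK.
Qed.

Variable R : realType.

Let sgrow_eqP w z a : reflect (forall b, sg w a b = sg z a b) (sgrow w a == sgrow z a).
Proof.
apply: (iffP eqP) => [/ffunP h b|h]; first by have := h b; rewrite !ffunE.
by apply/ffunP => b; rewrite !ffunE.
Qed.

Let rows_le I J a : leO I J -> lev (sgrow I a) (sgrow J a).
Proof. by move=> /leOP IJ; apply/levP => b; rewrite !ffunE. Qed.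

(** The analogue of [face_in] with whole rows in place of single coordinates. *)
Definition pseudo_fiber (A : {set 'I_n}) Z J0 : {set ordpart n} :=
  [set K in pseudo | leO Z K && [forall a in A, sgrow K a == sgrow J0 a]].

Lemma pseudo_fiberP (A : {set 'I_n}) Z J0 K : reflect [/\ K \in pseudo, leO Z K &
    forall a b, a \in A -> sg K a b = sg J0 a b] (K \in pseudo_fiber A Z J0).
Proof.
rewrite [K \in pseudo_fiber _ _ _]finset.in_set; apply: (iffP idP) => [/and3P[KP ZK /forall_inP h]|[KP ZK h]].
  by split => // a b /h /sgrow_eqP.
apply/and3P; split => //; by apply/forall_inP => a aA; apply/sgrow_eqP => b; exact: h.
Qed.

Lemma zeros_row I z e : sg I z e = szero -> forall b, sg I e b = sg I z b.
Proof. by move=> /eqP; rewrite sg_zero /sg => /eqP->. Qed.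

Lemma pseudo_fiber_exact A Z J0 e K0 : K0 \in pseudo_fiber A Z J0 ->
  [set K in pseudo_fiber A Z J0 | sgrow K e == sgrow K0 e] = pseudo_fiber (e |: A) Z K0.
Proof.
move=> /pseudo_fiberP[_ _ h0]; apply/setP => K; rewrite inE; apply/andP/pseudo_fiberP.
  move=> [/pseudo_fiberP[KP ZK h] /sgrow_eqP Ke]; split => // a b /finset.setU1P[->//|aA].
  by rewrite h// h0.
move=> [KP ZK h]; split; last by apply/sgrow_eqP => b; apply: h; exact: finset.setU11.
by apply/pseudo_fiberP; split => // a b aA; rewrite h ?h0// finset.setU1r.
Qed.

(** [K1] is the composition of [I] and [K0]. Its rows at [A] are those of [J0], and its row at [e]
    is that of [K0], which lies above the row of [I]. *)
Lemma pseudo_fiber_above A Z J0 e I K0 : I \in pseudo_fiber A Z J0 ->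
  K0 \in pseudo_fiber A Z J0 -> lev (sgrow I e) (sgrow K0 e) ->
  exists2 K1, K1 \in pseudo /\ leO I K1 &
  [set K in pseudo_fiber A Z J0 | leO I K && (sgrow K e == sgrow K0 e)] =
  pseudo_fiber (e |: A) I K1.
Proof.
move=> /pseudo_fiberP[IP ZI Ih] /pseudo_fiberP[K0P ZK0 K0h] /levP IK0.
have [K1 K1P eK1] := pseudo_comp IP K0P; exists K1.
  split=> //; apply/leOP => a b; rewrite eK1 /les /cs.
  by case: (sg I a b) => [[]|].
have K1A a b : a \in A -> sg K1 a b = sg J0 a b.
  by move=> aA; rewrite eK1 Ih// K0h//; case: (sg J0 a b).
have K1e b : sg K1 e b = sg K0 e b.
  have := IK0 b; rewrite eK1 !ffunE /les /cs.
  by case: (sg I e b) => [[]|] //= /eqP.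
apply/setP => K; rewrite inE; apply/and3P/pseudo_fiberP.
  move=> [/pseudo_fiberP[KP ZK h] IK /sgrow_eqP Ke]; split => // a b /finset.setU1P[->|aA].
    by rewrite K1e.
  by rewrite h ?K1A.
move=> [KP IK h]; split => //.
  apply/pseudo_fiberP; split => //; first exact: leO_trans ZI IK.
  by move=> a b aA; rewrite h ?K1A// finset.setU1r.
by apply/sgrow_eqP => b; rewrite h ?K1e// finset.setU11.
Qed.

(** Induction on the elements outside [A]. If [e] is tied to an element of [A], its row is already
    fixed. Otherwise that row is free only on the interval [D] around [e]; the possible rows are
    contractible by [convex_contr], and the fibers have [e] added to [A]. *)
Lemma pseudo_fiber_contr A Z J0 : Z \in pseudo -> J0 \in pseudo -> leO Z J0 ->
  fcontr R (compar (@leO n)) (pseudo_fiber A Z J0).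
Proof.
have [m] := ubnP #|~: A|; elim: m A Z J0 => // m IH A Z J0; rewrite ltnS => Am ZP J0P ZJ0.
have J0F : J0 \in pseudo_fiber A Z J0 by apply/pseudo_fiberP.
have [AT|] := boolP ([set: 'I_n] \subset A).
  apply: (fcontr_cone R (@leO_refl n) J0F) => K /pseudo_fiberP[KP ZK h].
  apply/orP; left; apply/leOP => a b; rewrite h ?les_refl//.
  by apply: (fintype.subsetP AT); rewrite inE.
move=> /subsetPn[e _ eA].
have IHe Z' K : Z' \in pseudo -> K \in pseudo -> leO Z' K ->
    fcontr R (compar (@leO n)) (pseudo_fiber (e |: A) Z' K).
  apply: IH; apply: leq_trans Am; apply: proper_card; apply/properP; split.
    by apply/fintype.subsetP => a; rewrite !inE negb_or => /andP[].
  by exists e; rewrite !inE ?eqxx.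
have [/exists_inP[z zA /eqP ze]|/exists_inPn nz] := boolP [exists z in A, sg J0 z e == szero].
  have := IHe Z J0 ZP J0P ZJ0; congr fcontr; rewrite -(pseudo_fiber_exact e J0F).
  apply/setP => K; rewrite inE; apply/andP/idP => [[]//|KF]; split => //.
  have /pseudo_fiberP[_ _ h] := KF; apply/sgrow_eqP => b.
  by rewrite (zeros_row ze) (@zeros_row K z e) ?h.
pose F := pseudo_fiber A Z J0; pose g K := sgrow K e.
apply: (@quillen_contr R _ _ (@leO n) (@lev 'I_n) g (@leO_refl n) (@leO_trans n)
  (@lev_refl 'I_n) (@lev_trans 'I_n) F (g @: F)).
- by move=> K; exact: imset_f.
- by move=> I J; exact: rows_le.
- pose D := [set a | [forall z in A, sg J0 z a == sg J0 z e]].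
  have rJ0 : sgrow J0 e \in L by move/pseudoP: J0P.
  rewrite (_ : g @: F = @face_in _ _ id L (e |: ~: D) (sgrow Z e) (sgrow J0 e)).
    apply: (@convex_contr R _ _ id L) => //; last exact: rows_le.
      by move=> x y xL yL; exists (compv x y) => //; exact: comp_L.
    by move=> x y a xL yL; exact: little_elim.
  apply/setP => X; apply/imsetP/idP.
    move=> [K /pseudo_fiberP[KP ZK h] ->]; rewrite inE; apply/and3P; split.
    + by move/pseudoP: KP => /(_ e).
    + exact: rows_le.
    + apply/forall_inP => a /finset.setU1P[->|].
        by rewrite !ffunE /sg /cmpn !ltnn.
      rewrite !inE => /forall_inPn[z zA za]; rewrite !ffunE.
      have ze := nz z zA; rewrite (sg_across ze za) -(h z e zA).
      by rewrite (@sg_across K z e a) ?h.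
  rewrite inE => /and3P[XL ZX /forall_inP XD].
  have Xe : X e = szero.
    by rewrite (eqP (XD e (finset.setU11 _ _))) ffunE /sg /cmpn ltnn.
  have [|J [JP JA Je]] := pseudo_realize J0P XL nz Xe.
    move=> a aD; rewrite (eqP (XD a _)) ?ffunE//.
    by rewrite !inE (negPf aD) orbT.
  (* Composing [Z] with [J] moves it above [Z] and keeps the rows at [A] and [e], which already lie
     above those of [Z]. *)
  have [K KP eK] := pseudo_comp ZP JP; exists K.
    apply/pseudo_fiberP; split => //.
      by apply/leOP => a b; rewrite eK /les /cs; case: (sg Z a b) => [[]|].
    move=> a b aA; have /eqP/sgrow_eqP Ja := JA a aA; rewrite eK Ja.
    by have /leOP/(_ a b) := ZJ0; rewrite /les /cs; case: (sg Z a b) => [[]|] //= /eqP.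
  apply/ffunP => b; rewrite /g ffunE eK (_ : sg J e b = X b); last by rewrite -Je ffunE.
  by have /levP/(_ b) := ZX; rewrite ffunE /les /cs; case: (sg Z e b) => [[]|] //= /eqP.
- move=> _ /imsetP[K0 K0F ->]; apply: fiber_contr.
  + exact: leO_refl.
  + exact: leO_trans.
  + exact: lev_refl.
  + rewrite pseudo_fiber_exact//.
    by move/pseudo_fiberP: K0F => [? ? _]; exact: IHe.
  + move=> I IF IK0; have [K1 [K1P IK1] ->] := pseudo_fiber_above IF K0F IK0.
    by move/pseudo_fiberP: IF => [? ? _]; exact: IHe.
Qed.

End Strings.

(** * Comparing sweeps and pseudo-sweeps by their rows at one element *)

Section PseudoSweeps.
Variables (n : nat) (M : {set {ffun pairs n -> sign}}).
Hypothesis hM : sweep_oriented_matroid M.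
Implicit Types (I J K : ordpart n) (a b c e o : 'I_n).

Let L := little_om M.

Definition level I (i : nat) : {ffun 'I_n -> sign} := [ffun a => cmpn i.+1 (block_index I a)].

Lemma level_row I c : level I (block_index I c).-1 = sgrow I c.
Proof. by apply/ffunP => a; rewrite !ffunE prednK. Qed.

(** The zero sets determine a cellular string: starting from +, each junction condition fixes the
    signs off the next zero set. So its members are the levels of [I], which are rows. Conversely a
    row is no tope, since it vanishes somewhere and composing it with + enlarges it. *)
Lemma pseudo_sweepsP I : pseudo_sweeps L I <-> I \in pseudo M.
Proof.
split.
  move=> [s [sL hd _ srt] bs]; apply/pseudoP => c; rewrite -level_row.
  have szs : size s = size (blocks I) by rewrite bs size_map.
  pose d : {ffun 'I_n -> sign} := [ffun=> szero].
  have zs i a : i < size s -> (nth d s i a == szero) = (block_index I a == i.+1).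
    by move=> si; rewrite -mem_block -?szs// bs (nth_map d)// inE.
  have E i : i < size s -> nth d s i = level I i.
    elim: i => [|i IH] si.
      apply/ffunP => a; have := zs 0 a si; move/ffunP/(_ a): hd.
      rewrite -nth0 (set_nth_default d)// !ffunE; have p0 : 0 < block_index I a by [].
      case: (nth d s 0 a) => [[]|] //= _ h; apply/esym/eqP.
        by rewrite cmpn_pos; have := negbT (esym h : (block_index I a == 1) = false); lia.
      by rewrite cmpn_zero eq_sym -h.
    have /IH Ei : i < size s by exact: ltnW.
    have /eqP/ffunP st := (sortedP d srt) i si.
    apply/ffunP => a; have := zs i.+1 a si; move: (st a); rewrite Ei !ffunE.
    case: (nth d s i.+1 a) => [[]|] //= h1 h; apply/esym/eqP.
    - have := negbT (esym h : (block_index I a == i.+2) = false).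
      by rewrite cmpn_pos; move: h1; rewrite /cmpn; case: ltngtP => //=; lia.
    - by rewrite cmpn_neg; move: h1; rewrite /cmpn; case: ltngtP => //=; lia.
    - by rewrite cmpn_zero eq_sym -h.
  have [cs _] := block_indexP I c; rewrite -szs in cs.
  by rewrite -E//; have /andP[] := sL _ (mem_nth d cs).
move/pseudoP => PI; exists [seq level I i | i <- iota 0 (size (blocks I))].
  have lvl i : i < size (blocks I) -> exists2 c, block_index I c = i.+1 & level I i = sgrow I c.
    move=> iI; have [c] := @block_nonempty _ I _ (mem_nth finset.set0 iI).
    by rewrite mem_block// => /eqP pc; exists c => //; rewrite -level_row pc.
  have h0 a : 0 < size (blocks I) by apply: leq_trans (block_index_le I a).
  split.
  - move=> X /mapP[i]; rewrite mem_iota /= => /lvl[c pc ->] ->.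
    have rL : sgrow I c \in L := PI c; rewrite rL /=; apply/negP => /andP[_ /forall_inP].
    have cL : compv (sgrow I c) [ffun=> spos] \in L.
      by apply: little_comp => //; exact: little_const.
    move=> /(_ _ cL); rewrite lev_comp => /eqP/ffunP/(_ c).
    by rewrite !ffunE /sg /cmpn ltnn.
  - apply/ffunP => a; have := h0 a; case: (size (blocks I)) => //= m _.
    rewrite !ffunE; have p0 : 0 < block_index I a by [].
    by rewrite /cmpn; case: ltngtP => //=; lia.
  - apply/ffunP => a; have := block_index_le I a; have := h0 a.
    case sz : (size (blocks I)) => [//|m] _ pa.
    rewrite -(addn1 m) iotaD map_cat last_cat /= add0n !ffunE /cmpn.
    by case: ltngtP => //=; lia.
  - apply/(sortedP (posv _)) => i; rewrite size_map size_iota => iI.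
    rewrite !(nth_map 0) ?size_iota ?nth_iota//; try exact: ltnW.
    apply/eqP/ffunP => a; rewrite !ffunE /cmpn !add0n.
    by case: (ltngtP i.+1 (block_index I a)) => h1;
      case: (ltngtP i.+2 (block_index I a)) => h2 //=; lia.
apply: (@eq_from_nth _ finset.set0); first by rewrite !size_map size_iota.
move=> i iI; rewrite -map_comp (nth_map 0) ?size_iota// nth_iota//=.
by apply/setP => a; rewrite mem_block// inE ffunE add0n cmpn_zero eq_sym.
Qed.

Lemma trivialP I o : trivial_sweep I <-> sgrow I o = zerov 'I_n.
Proof.
split=> [tI|/ffunP h].
  apply/ffunP => a; rewrite !ffunE; apply/eqP; rewrite sg_zero /block_index tI /=.
  by rewrite !inE.
have po a : block_index I a = block_index I o.
  by apply/eqP; rewrite eq_sym -sg_zero; have := h a; rewrite !ffunE => ->.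
have all i : i < size (blocks I) -> i.+1 = block_index I o.
  move=> iI; have [c] := @block_nonempty _ I _ (mem_nth finset.set0 iI).
  by rewrite mem_block// po => /eqP.
have [oI _] := block_indexP I o.
have s1 : size (blocks I) = 1.
  have := all 0; have := all (size (blocks I)).-1; have : 0 < block_index I o by []; lia.
have po1 : block_index I o = 1 by rewrite -(all 0) ?s1.
rewrite /trivial_sweep.
case: (blocks I) s1 (fun a => @mem_block _ I 0 a) => // B [|//] _ mb.
by congr (_ :: _); apply/setP => a; rewrite inE; have := mb a isT; rewrite /= po po1.
Qed.

Variable R : realType.

(** [nt] selects the half of the theorem. Nontriviality depends only on the row at [o], hence is
    constant on exact fibers. *)
Lemma sweeps_sdr o (nt : bool) :
  fsdr R (compar (@leO n))
    [set I | (sweep_vec I \in M) && (nt ==> (sgrow I o != zerov 'I_n))]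
    [set I in pseudo M | nt ==> (sgrow I o != zerov 'I_n)].
Proof.
pose ntr I := nt ==> (sgrow I o != zerov 'I_n).
pose P : {set ordpart n} := [set I in pseudo M | ntr I].
pose Q : {set ordpart n} := [set I | (sweep_vec I \in M) && ntr I].
pose g I := sgrow I o.
have rows_le I J : leO I J -> lev (g I) (g J).
  by move=> /leOP IJ; apply/levP => b; rewrite !ffunE.
have [Z ZM Z0] := sweep_zero hM.
have sweep_pseudo I : sweep_vec I \in M -> I \in pseudo M.
  by move=> IM; apply/pseudoP => c; exact: row_little.
have Zle I : leO Z I by apply/leOP => a b; rewrite Z0.
have QP : Q \subset P.
  by apply/fintype.subsetP => I; rewrite !inE => /andP[/sweep_pseudo + ->]; rewrite inE => ->.
have ntr_g I J : g I = g J -> ntr I = ntr J by rewrite /ntr -![sgrow _ o]/(g _) => ->.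
apply: (@quillen_sdr R _ _ (@leO n) (@lev 'I_n) g (@leO_refl n) (@leO_trans n)
  (@lev_refl 'I_n) (@lev_trans 'I_n) P (g @: P)) => //.
- by move=> K; exact: imset_f.
- move=> _ /imsetP[K0 K0P ->].
  have inP K : (K \in P) = (K \in pseudo M) && ntr K by rewrite [LHS]finset.in_set.
  have [K0p K0n] : K0 \in pseudo M /\ ntr K0 by move: K0P; rewrite inP => /andP.
  have K0F : K0 \in pseudo_fiber M finset.set0 Z K0.
    by apply/pseudo_fiberP; split => //; exact: Zle.
  have KF K : K \in pseudo M -> K \in pseudo_fiber M finset.set0 Z K0.
    by move=> KP; apply/pseudo_fiberP; split => // a b; rewrite inE.
  apply: fiber_contr; [exact: leO_refl|exact: leO_trans|exact: lev_refl|..].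
  + rewrite (_ : [set _ in _ | _] =
        [set K in pseudo_fiber M finset.set0 Z K0 | g K == g K0]).
      by rewrite (pseudo_fiber_exact _ K0F); apply: pseudo_fiber_contr => //; exact: sweep_pseudo.
    apply/setP => K; rewrite [LHS]finset.in_set [RHS]finset.in_set inP.
    apply/andP/andP => [[/andP[/KF //]]|[/pseudo_fiberP[Kp _ _] /eqP gK]].
    by rewrite Kp (ntr_g _ _ gK) K0n gK.
  + move=> I; rewrite inP => /andP[Ip _] gI.
    have [K1 [K1P IK1] e1] := pseudo_fiber_above hM (KF I Ip) K0F gI.
    rewrite (_ : [set _ in _ | _] = [set K in pseudo_fiber M finset.set0 Z K0 |
        leO I K && (g K == g K0)]).
      by rewrite e1; exact: pseudo_fiber_contr.
    apply/setP => K; rewrite [LHS]finset.in_set [RHS]finset.in_set inP.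
    apply/andP/andP => [[/andP[/KF //]]|[/pseudo_fiberP[Kp _ _] /andP[IK /eqP gK]]].
    by rewrite Kp (ntr_g _ _ gK) K0n gK IK eqxx.
- move=> _ /imsetP[K0 K0P ->].
  have [K0p K0n] : K0 \in pseudo M /\ ntr K0 by move: K0P; rewrite inE => /andP.
  (* The row of [K0] at [o] is a covector of L vanishing at [o], hence the row of some sweep. *)
  have [I0 I0M gI0] : exists2 I0, sweep_vec I0 \in M & g I0 = g K0.
    have /pseudoP/(_ o)/little_omP[I0 I0M cI0] := K0p; exists I0 => //.
    by apply/esym/compatible_row => //; rewrite ffunE /sg /cmpn ltnn.
  have I0n : ntr I0 by rewrite (ntr_g _ _ gI0).
  pose N : {set ordpart n} := [set I | sweep_vec I \in M].
  (* Fixing the row at [o] means fixing the coordinates at all pairs containing [o]. *)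
  pose A : {set pairs n} := [set e | ((val e).1 == o) || ((val e).2 == o)].
  have AP I J : reflect (g I = g J) [forall e in A, sweep_vec I e == sweep_vec J e].
    apply: (iffP forall_inP) => [h|/ffunP h e].
      apply/ffunP => a; rewrite !ffunE.
      suff q : forall b c, (b == o) || (c == o) -> sg I b c = sg J b c by rewrite q ?eqxx.
      apply: pairsP => [b _|b c ih|e eo]; first by rewrite /sg /cmpn !ltnn.
        by rewrite orbC => /ih; rewrite (sg_opp I b c) (sg_opp J b c) => ->.
      by have := h e; rewrite inE !sweep_vecE => /(_ eo)/eqP.
    rewrite inE !sweep_vecE => /orP[/eqP|/eqP] ->.
      by have := h (val e).2; rewrite !ffunE => ->.
    rewrite (sg_opp I o) (sg_opp J o).
    by have := h (val e).1; rewrite !ffunE => ->.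
  have Ncomp I J : I \in N -> J \in N ->
      exists2 K, K \in N & sweep_vec K = compv (sweep_vec I) (sweep_vec J).
    rewrite !inE => IM JM; have [K [KM eK _]] := sweep_comp hM IM JM.
    by exists K; rewrite ?inE.
  have face_contr X J : J \in N -> lev X (sweep_vec J) ->
      fcontr R (compar (@leO n)) (face_in (@sweep_vec n) N A X J).
    apply: convex_contr => // I I' e IN I'N sep.
    have IM : sweep_vec I \in M by move: IN; rewrite inE.
    have I'M : sweep_vec I' \in M by move: I'N; rewrite inE.
    have [[_ _ _ Me] hI] := hM.
    have [Y [YM Ye Yf]] := Me _ _ e IM I'M sep.
    by have [K eK] := hI _ YM; exists K; rewrite inE -eK.
  apply: fiber_contr; [exact: leO_refl|exact: leO_trans|exact: lev_refl|..].
  + rewrite (_ : [set _ in _ | _] = face_in (@sweep_vec n) N A (zerov _) I0).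
      apply: face_contr; rewrite ?inE//.
      by apply/levP => e; rewrite ffunE.
    apply/setP => I; rewrite !finset.in_set; apply/andP/and3P.
      move=> [/andP[IM In] /eqP gI]; split => //; last by apply/AP; rewrite gI gI0.
      by apply/levP => e; rewrite ffunE.
    move=> [IM _ /AP gI]; rewrite IM -/(ntr I) (ntr_g _ _ gI) I0n gI gI0.
    by split.
  + move=> I; rewrite finset.in_set => /andP[IM In] /levP gI.
    have [K1 [K1M eK1 sK1]] := sweep_comp hM IM I0M.
    have gK1 : g K1 = g K0.
      rewrite -gI0; apply/ffunP => a; have := gI a; rewrite -gI0 !ffunE sK1 /les /cs.
      by case: (sg I o a) => [[]|] //= /eqP.
    rewrite (_ : [set _ in _ | _] = face_in (@sweep_vec n) N A (sweep_vec I) K1).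
      by apply: face_contr; rewrite ?inE// eK1 lev_comp.
    apply/setP => J; rewrite !finset.in_set; apply/andP/and3P.
      by move=> [/andP[JM Jn] /andP[IJ /eqP gJ]]; split => //; apply/AP; rewrite gJ gK1.
    move=> [JM IJ /AP gJ]; rewrite JM -/(ntr J) (ntr_g J K0) ?gJ// K0n gK1.
    by split=> //; rewrite eqxx andbT.
Qed.

End PseudoSweeps.

Lemma realization_geo (R : realType) n (S : set (ordpart n)) (F : {set ordpart n}) :
  (forall I, S I <-> I \in F) ->
  realization (R := R) (order_complex (@refines n) S) = geo (compar (@leO n)) F.
Proof.
move=> SF; apply/seteqP; split => w [w0 w1].
  move=> [_ wS wc]; split => // [I wI|I J wI wJ].
    by apply/SF/wS; rewrite inE.
  have [] := wc I J; rewrite ?inE// => /refinesP h; rewrite /compar h ?orbT//.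
move=> wS wc; split => //; split.
- apply/set0Pn; apply: contrapT => h; move: w1; rewrite big1 => [/eqP|I _].
    by rewrite eq_sym GRing.oner_eq0.
  by apply: contrapT => /eqP wI; apply: h; exists I; rewrite inE.
- by move=> I; rewrite inE => /wS/SF.
- move=> I J; rewrite !inE => wI wJ; have := wc I J wI wJ.
  by rewrite /compar => /orP[|] /refinesP; [right|left].
Qed.

Lemma ordpart0 (I J : ordpart 0) : I = J.
Proof.
have b0 (K : ordpart 0) : blocks K = [::].
  apply/nilP; rewrite /nilp; case sz : (size (blocks K)) => [//|m].
  have : nth finset.set0 (blocks K) 0 \in blocks K by rewrite mem_nth ?sz.
  by move=> /block_nonempty[[]].
by apply: val_inj; apply: val_inj; rewrite -[LHS]/(blocks I) -[RHS]/(blocks J) !b0.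
Qed.

Theorem theorem6p6 (R : realType) (n : nat)
    (M : {set {ffun pairs n -> sign}}) (hM : sweep_oriented_matroid M) :
  poset_sdr R (@refines n) (sweeps M) (pseudo_sweeps (little_om M)) /\
  poset_sdr R (@refines n) (nontrivial (sweeps M))
    (nontrivial (pseudo_sweeps (little_om M))).
Proof.
(* For [n] equal to 0 there is no element [o], but there is only the empty ordered partition and the
   posets coincide. *)
case: n M hM => [|n] M hM.
  have E (A B : set (ordpart 0)) : (forall I, A I <-> B I) -> poset_sdr R (@refines 0) A B.
    by move=> AB; rewrite /poset_sdr (_ : A = B); [exact: sdr_refl|apply/seteqP; split=> I /AB].
  have AB I : sweeps M I <-> pseudo_sweeps (little_om M) I.
    rewrite pseudo_sweepsP//; split=> _.
      by apply/pseudoP => -[].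
    have [K KM _] := sweep_zero hM; by rewrite (ordpart0 I K).
  by split; apply: E => // I; split=> -[/AB].
have main (nt : bool) (A B : set (ordpart n.+1)) :
    (forall I, A I <-> sweeps M I /\ (nt -> ~ trivial_sweep I)) ->
    (forall I, B I <-> pseudo_sweeps (little_om M) I /\ (nt -> ~ trivial_sweep I)) ->
    poset_sdr R (@refines n.+1) A B.
  move=> hA hB.
  have ntP I : (nt -> ~ trivial_sweep I) <-> (nt ==> (sgrow I ord0 != zerov 'I_n.+1)).
    split=> [h|/implyP h /h /eqP + /trivialP]; last by move=> + /(_ ord0).
    by apply/implyP => /h h'; apply/eqP => /trivialP.
  have := sweeps_sdr hM R ord0 nt; rewrite /fsdr /poset_sdr.
  rewrite -(@realization_geo R _ A) -?(@realization_geo R _ B)//.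
    by move=> I; rewrite hB pseudo_sweepsP// ntP finset.in_set; split=> /andP.
  by move=> I; rewrite hA ntP inE; split=> /andP.
split; first by apply: (main false) => I; split=> [|[]].
by apply: (main true) => I; split=> -[h t]; split=> //; exact: t.
Qed.
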